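(* Let $A$ be a completely non-unitary contraction in a separable Hilbert space $\mathfrak H$ with $\ker D_A\neq\{0\}$, and let $\mathfrak H_{n,m}$, $P_{n,m}$, $A_{n,m}$, $\mathcal A_{n,m}$ ($n,m\ge0$) be as defined in the context. (1) The following relations hold for all integers $n,m\ge0$ (unless restricted otherwise): $$\ker D_{A^k_{n,m}}=\mathfrak H_{n+k,m},\qquad \ker D_{A^{*k}_{n,m}}=\mathfrak H_{n,m+k},\qquad k=1,2,\ldots;$$ $$\mathfrak D_{A_{n,m}}=\overline{\operatorname{ran}}\,(P_{n,m}D_{A^{n+1}}),\qquad \mathfrak D_{A^*_{n,m}}=\overline{\operatorname{ran}}\,(P_{n,m}D_{A^{*(m+1)}});$$ $$A\mathfrak H_{n,m}=\mathfrak H_{n-1,m+1}\ (n\ge1),\qquad A^*\mathfrak H_{n,m}=\mathfrak H_{n+1,m-1}\ (m\ge1);$$ $$\ker D_{\mathcal A^k_{n,m}}=\mathfrak H_{n+k,m},\qquad \ker D_{\mathcal A^{*k}_{n,m}}=\mathfrak H_{n,m+k},\qquad k=1,2,\ldots;$$ $$\mathfrak D_{\mathcal A_{n,m}}=\mathfrak D_{A_{n,m}},\qquad \mathfrak D_{\mathcal A^*_{n,m}}=\mathfrak D_{A^*_{n,m}};$$ $$(A_{n,m})_{k,l}=A_{n+k,m+l},\qquad k,l\ge 0,$$ where $(A_{n,m})_{k,l}$ denotes the result of applying the construction $A\mapsto A_{k,l}$ to the operator $A_{n,m}$ in the space $\mathfrak H_{n,m}$. (2) The operators $A_{n,m}$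 and $\mathcal A_{n,m}$ are completely non-unitary contractions. (3) For each $n\geq 1$ the operators $A_{n,0},A_{n-1,1},\ldots,A_{n-k,k},\ldots,A_{0,n}$ are unitarily equivalent, and $$A_{n-1,m+1}Af=AA_{n,m}f,\qquad f\in\mathfrak H_{n,m},\ n\ge1.$$ (4) For each $n\geq 1$ the operators $\mathcal A_{n,0},\mathcal A_{n-1,1},\ldots,\mathcal A_{n-k,k},\ldots,\mathcal A_{0,n}$ are unitarily equivalent, and $$\mathcal A_{n-1,m+1}Af=A\mathcal A_{n,m}f,\qquad f\in\mathfrak H_{n,m},\ n\ge1.$$ (5) For a given $n\ge0$ the following statements are equivalent: (i) $\mathcal A_{n,0}\in C_{\cdot\,0}$ (respectively $\mathcal A_{n,0}\in C_{0\,\cdot}$); (ii) $A_{n+1-k,k}\in C_{\cdot\,0}$ (respectively $A_{n+1-k,k}\in C_{0\,\cdot}$) for all $k=0,1,\ldots,n+1$.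
   Context: For a contraction $T\in\mathbf L(\mathfrak H_1,\mathfrak H_2)$ between Hilbert spaces: $D_T=(I-T^*T)^{1/2}$, $D_{T^*}=(I-TT^* )^{1/2}$, $\mathfrak D_T=\overline{\operatorname{ran}}\,D_T$, $\mathfrak D_{T^*}=\overline{\operatorname{ran}}\,D_{T^*}$. A contraction is completely non-unitary if it has no nontrivial reducing subspace on which it is unitary. A contraction $T$ belongs to $C_{0\,\cdot}$ if $T^n\to0$ strongly, and to $C_{\cdot\,0}$ if $T^{*n}\to0$ strongly. For a contraction $A$ in $\mathfrak H$ set $\mathfrak H_{0,0}=\mathfrak H$, $\mathfrak H_{n,0}=\ker D_{A^n}$, $\mathfrak H_{0,m}=\ker D_{A^{*m}}$, $\mathfrak H_{n,m}=\ker D_{A^n}\cap\ker D_{A^{*m}}$ for $n,m\ge1$; $P_{n,m}$ is the orthogonal projection in $\mathfrak H$ onto $\mathfrak H_{n,m}$; $A_{n,m}=P_{n,m}A\upharpoonright\mathfrak H_{n,m}\in\mathbf L(\mathfrak H_{n,m})$; $\mathcal A_{n,m}=A_{n,m}P_{n+1,m}\upharpoonright\mathfrak H_{n,m}\in\mathbf L(\mathfrak H_{n,m})$ (note $\mathfrak H_{n+1,m}\subset\mathfrak H_{n,m}$). Powers such as $A^k_{n,m}$ mean $(A_{n,m})^k$, and $A^{*k}_{n,m}=((A_{n,m})^* )^k$; similarly for $\mathcal A_{n,m}$. *)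

(* Defs.v *)
From HB Require Import structures.
From mathcomp Require Import all_boot all_order all_algebra.
From mathcomp Require Import complex.
From mathcomp Require Import all_classical all_reals all_analysis.

Set Implicit Arguments.
Unset Strict Implicit.
Unset Printing Implicit Defensive.

Import Order.TTheory GRing.Theory Num.Theory.
Import numFieldNormedType.Exports.

Local Open Scope classical_set_scope.
Local Open Scope ring_scope.

(* A complex Hilbert space: a complete normed space over R[i] whose norm comes
   from an inner product, linear in the first argument and conjugate-linear in
   the second. The norm of H takes its values in R[i]. *)
HB.mixin Record NormedModule_isHilbert (R : realType) H
    of CompleteNormedModule R[i] H := {
  hdot : {dot H for (@Num.conj R[i])} ;
  hdot_norm : forall x : H, hdot x x = `|x| ^+ 2
}.

#[short(type="hilbertType")]
HB.structure Definition Hilbert (R : realType) :=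
  {H of NormedModule_isHilbert R H & CompleteNormedModule R[i] H}.

Definition separable_space (T : topologicalType) : Prop :=
  exists2 B : set T, countable B & dense B.

(* Operators of L(M), for M a closed subspace of H (possibly M = setT), are
   represented by functions H -> H of which only the values on M matter. Every
   notion below is relative to M, i.e. it is the notion for the Hilbert space
   M and not for the ambient space H. *)
Section Operators.
Variables (R : realType) (H : hilbertType R).
Implicit Types (M N : set H) (T S B U : H -> H).

Definition closed_subspace M : Prop :=
  [/\ closed M, M 0 & forall (a : R[i]) x y, M x -> M y -> M (a *: x + y)].

Definition linear_on M T : Prop :=
  forall (a : R[i]) x y, M x -> M y -> T (a *: x + y) = a *: T x + T y.

Definition bounded_op M T : Prop :=
  [/\ set_fun M M T, linear_on M T &
      exists c : R[i], forall x, M x -> `|T x| <= c * `|x|].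

Definition contraction_op M T : Prop :=
  [/\ set_fun M M T, linear_on M T & forall x, M x -> `|T x| <= `|x|].

Definition orth_proj M (x : H) : H :=
  xget 0 [set y | M y /\ forall z, M z -> hdot (x - y) z = 0].

(* T^*, the adjoint of T in L(M) *)
Definition adjoint M T (y : H) : H :=
  xget 0 [set z | M z /\ forall x, M x -> hdot (T x) y = hdot x z].

(* In R[i], 0 <= z says that z is real and nonnegative, so that this condition
   implies self-adjointness. *)
Definition positive_op M T : Prop := forall x, M x -> 0 <= hdot (T x) x.

(* B^(1/2), the positive square root of B in L(M) *)
Definition op_sqrt M B : H -> H :=
  xget (fun=> 0) [set S | [/\ bounded_op M S, positive_op M S &
                             forall x, M x -> S (S x) = B x]].

(* D_T = (I - T^* T)^(1/2) *)
Definition defect_op M T : H -> H :=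
  op_sqrt M (fun x => x - adjoint M T (T x)).

Definition op_ker M T : set H := [set x | M x /\ T x = 0].

Definition defect_space M T : set H := closure (defect_op M T @` M).

Definition unitary_op M N U : Prop :=
  [/\ set_bij M N U, linear_on M U &
      forall x y, M x -> M y -> hdot (U x) (U y) = hdot x y].

Definition unitarily_equivalent M T N S : Prop :=
  exists U, unitary_op M N U /\ forall x, M x -> U (T x) = S (U x).

Definition reducing M T N : Prop :=
  [/\ closed_subspace N, N `<=` M, T @` N `<=` N &
      adjoint M T @` N `<=` N].

Definition completely_nonunitary M T : Prop :=
  forall N, reducing M T N -> unitary_op N N T -> N = [set 0].

Definition strongly_stable M T : Prop :=
  forall x, M x -> (fun k : nat => iter k T x) @ \oo --> (0 : H).

Definition class_C0_ M T : Prop := strongly_stable M T.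

Definition class_C_0 M T : Prop := strongly_stable M (adjoint M T).

(* For A in L(M), the subspace of M written H_{n,m} *)
Definition trunc_space M (A : H -> H) (n m : nat) : set H :=
  let kerDA := op_ker M (defect_op M (iter n A)) in
  let kerDA' := op_ker M (defect_op M (iter m (adjoint M A))) in
  match n, m with
  | 0, 0 => M
  | _.+1, 0 => kerDA
  | 0, _.+1 => kerDA'
  | _.+1, _.+1 => kerDA `&` kerDA'
  end.

(* A_{n,m}, an operator in trunc_space M A n m *)
Definition trunc_op M (A : H -> H) (n m : nat) : H -> H :=
  fun x => orth_proj (trunc_space M A n m) (A x).

(* The calligraphic A_{n,m}, an operator in trunc_space M A n m *)
Definition cal_trunc_op M (A : H -> H) (n m : nat) : H -> H :=
  fun x => trunc_op M A n m (orth_proj (trunc_space M A n.+1 m) x).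

End Operators.

(* Main.v *)
Require Import Defs.
From HB Require Import structures.
From mathcomp Require Import all_boot all_order all_algebra.
From mathcomp Require Import complex.
From mathcomp Require Import ring lra.
From mathcomp Require Import all_classical all_reals all_analysis.

Set Implicit Arguments.
Unset Strict Implicit.
Unset Printing Implicit Defensive.

Import Order.TTheory GRing.Theory Num.Theory.
Import numFieldNormedType.Exports.

Local Open Scope classical_set_scope.
Local Open Scope ring_scope.

(** In the kernel of the defect operator of a contraction T lie exactly the vectors
    whose norm T preserves, since the squared norm of D_T x is |x|^2 - |T x|^2
    ([nsq_defect], [ker_defectE]).  Hence H_(n,m) consists of the x such that A^n
    and A^*m preserve the norm of x.  As A^* undoes A at such vectors, A maps
    H_(n+1,m) unitarily onto H_(n,m+1), with inverse A^*, and intertwines the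
    projections, P_(n,m+1) A = A P_(n+1,m) ([proj_intertwine]).  This gives the
    intertwining relations and, along an antidiagonal, the unitary equivalences.

    Both operators attached to H_(n,m) are contractions B of H_(n,m) that agree
    with A on H_(n+1,m) and preserve the norm of no vector outside H_(n+1,m).
    Such a B is called a truncation below, and these properties alone determine
    the kernels of the defect operators of its powers ([truncation_iter]),
    its defect space, namely the orthogonal complement of H_(n+1,m) in H_(n,m),
    and the spaces obtained by applying the construction again; they also make B
    completely non-unitary ([truncation_cnu]).  Moreover the adjoint of a
    truncation of A is a truncation of A^* with the two indices exchanged
    ([truncation_adjoint]), which yields every statement about adjoints.

    For the stability classes, let Q be the projection on H_(n+1,0).  The
    calligraphic truncation to H_(n,0) is A Q, and A_(n+1,0) is the restriction of
    Q A, so that the powers of each are controlled by those of the other, and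
    likewise for the adjoints; the remaining operators A_(n+1-k,k) are unitarily
    equivalent to A_(n+1,0).

    The rest is the Hilbert space theory on which this depends: the Riesz
    representation theorem, proved by minimisation, which gives projections and
    adjoints ([riesz_minimisation]), and the square root of I - T^*T
    ([sqrt_exists]). *)

(** * The underlying real inner product space *)

Section RealInnerProduct.
Variables (R : realType) (H : hilbertType R).
Implicit Types (x y z : H) (a b : R).

(** The real part of the inner product carries all the metric information, takes
    its values in R, where inequalities can be computed with, and determines the
    inner product by means of multiplication by i. *)
Definition rdot x y : R := complex.Re (hdot x y).
Definition nsq x : R := rdot x x.
Definition imul x : H := 'i%C *: x.

Lemma hdotC x y : hdot y x = (hdot x y)^*%C.
Proof. by rewrite hermC expr0 mul1r. Qed.

Lemma rdotC x y : rdot x y = rdot y x.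
Proof. by rewrite /rdot (hdotC y x); case: (hdot y x). Qed.

Lemma rdotDl x y z : rdot (x + y) z = rdot x z + rdot y z.
Proof. by rewrite /rdot linearDl /=; case: (hdot x z) (hdot y z) => ? ? []. Qed.

Lemma rdotDr x y z : rdot z (x + y) = rdot z x + rdot z y.
Proof. by rewrite !(rdotC z) rdotDl. Qed.

Lemma rdotZl a x z : rdot (a%:C%C *: x) z = a * rdot x z.
Proof.
by rewrite /rdot linearZl_LR /=; case: (hdot x z) => u v /=; rewrite mul0r subr0.
Qed.

Lemma rdotZr a x z : rdot z (a%:C%C *: x) = a * rdot z x.
Proof. by rewrite !(rdotC z) rdotZl. Qed.

Lemma rdotNl x z : rdot (- x) z = - rdot x z.
Proof. by rewrite /rdot linearNl /=; case: (hdot x z). Qed.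

Lemma rdotNr x z : rdot z (- x) = - rdot z x.
Proof. by rewrite !(rdotC z) rdotNl. Qed.

Lemma rdotBl x y z : rdot (x - y) z = rdot x z - rdot y z.
Proof. by rewrite rdotDl rdotNl. Qed.

Lemma rdotBr x y z : rdot z (x - y) = rdot z x - rdot z y.
Proof. by rewrite rdotDr rdotNr. Qed.

Lemma rdot0l x : rdot 0 x = 0.
Proof. by rewrite -(subrr 0) rdotBl subrr. Qed.

Lemma rdot0r x : rdot x 0 = 0.
Proof. by rewrite rdotC rdot0l. Qed.

Lemma Im_hdot x y : complex.Im (hdot x y) = rdot x (imul y).
Proof.
rewrite /rdot /imul linearZr_LR /=; case: (hdot x y) => u v /=.
by rewrite mul0r mulN1r opprK add0r.
Qed.

Lemma rdot_imull x y : rdot (imul x) y = - rdot x (imul y).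
Proof.
rewrite -Im_hdot /rdot /imul linearZl_LR /=; case: (hdot x y) => u v /=.
by rewrite mul0r mul1r sub0r.
Qed.

Lemma imulK x : imul (imul x) = - x.
Proof. by rewrite /imul scalerA -expr2 sqr_i scaleN1r. Qed.

Lemma hdot_eqP x y x' y' :
  hdot x y = hdot x' y' <->
  rdot x y = rdot x' y' /\ rdot x (imul y) = rdot x' (imul y').
Proof.
rewrite -!Im_hdot /rdot; split=> [->//|[]].
by case: (hdot x y) (hdot x' y') => ? ? [? ?] /= -> ->.
Qed.

Lemma nsq_norm x : (nsq x)%:C%C = `|x| ^+ 2 :> R[i].
Proof.
rewrite -hdot_norm /nsq /rdot RRe_real//.
by apply: ger0_real; rewrite hdot_norm exprn_ge0.
Qed.

Lemma nsq_ge0 x : 0 <= nsq x.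
Proof. by rewrite -(@lecR R) nsq_norm exprn_ge0. Qed.

Lemma nsq_eq0 x : nsq x = 0 -> x = 0.
Proof.
move=> e; have := nsq_norm x; rewrite e => /esym/eqP.
by rewrite sqrf_eq0 normr_eq0 => /eqP.
Qed.

Lemma nsq_gt0 x : x != 0 -> 0 < nsq x.
Proof.
move=> x0; rewrite lt_neqAle nsq_ge0 andbT eq_sym.
by apply: contra_neq x0 => /nsq_eq0.
Qed.

Lemma nsq0 : nsq 0 = 0. Proof. exact: rdot0l. Qed.

Lemma nsqN x : nsq (- x) = nsq x.
Proof. by rewrite /nsq rdotNl rdotNr opprK. Qed.

Lemma nsqZ a x : nsq (a%:C%C *: x) = a ^+ 2 * nsq x.
Proof. by rewrite /nsq rdotZl rdotZr mulrA. Qed.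

Lemma nsqD x y : nsq (x + y) = nsq x + 2 * rdot x y + nsq y.
Proof. by rewrite /nsq !rdotDl !rdotDr (rdotC y x); ring. Qed.

Lemma nsqB x y : nsq (x - y) = nsq x - 2 * rdot x y + nsq y.
Proof. by rewrite nsqD nsqN rdotNr mulrN. Qed.

Lemma nsqBC x y : nsq (x - y) = nsq (y - x).
Proof. by rewrite -nsqN opprB. Qed.

Lemma ler_nsq x y : (`|x| <= `|y|) = (nsq x <= nsq y).
Proof.
by rewrite -(@lecR R) !nsq_norm ler_sqr// nnegrE.
Qed.

Lemma cauchy_schwarz x y : rdot x y ^+ 2 <= nsq x * nsq y.
Proof.
have [->|x0] := eqVneq x 0; first by rewrite rdot0l nsq0 mul0r expr0n.
have := nsq_ge0 ((nsq x)%:C%C *: y - (rdot x y)%:C%C *: x).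
rewrite nsqB !nsqZ rdotZl rdotZr (rdotC y x) => h.
have := nsq_gt0 x0; nra.
Qed.

Lemma nsqD_le x y : nsq (x + y) <= 2 * nsq x + 2 * nsq y.
Proof. by have := nsq_ge0 (x - y); rewrite nsqB nsqD; lra. Qed.

Lemma nsq_trans x y z : nsq (x - z) <= 2 * nsq (x - y) + 2 * nsq (y - z).
Proof. by have := nsqD_le (x - y) (y - z); rewrite addrA subrK. Qed.

Lemma norm_lt_nsq x (e : R) : 0 < e -> (`|x| < e%:C%C) = (nsq x < e ^+ 2).
Proof.
move=> e0.
have e0' : 0 <= e%:C%C :> R[i] by rewrite (@lecR R) ltW.
by rewrite -(@ltcR R) nsq_norm rmorphXn /= ltr_sqr// nnegrE.
Qed.


(** * Convergence and completeness in terms of squared norms *)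

Lemma gtc0_real (e : R[i]) : 0 < e -> exists2 r : R, 0 < r & e = r%:C%C.
Proof.
by case: e => r s; rewrite ltcE /= => /andP[/eqP-> r0]; exists r.
Qed.

Lemma cvg_nsqP (u : nat -> H) l :
  u @ \oo --> l <-> nsq (u n - l) @[n --> \oo] --> (0 : R).
Proof.
split=> [/cvgrPdist_lt h|/cvgrPdist_lt h]; apply/cvgrPdist_lt => e e0.
  have s0 : 0 < Num.sqrt e by rewrite sqrtr_gt0.
  have s0' : 0 < (Num.sqrt e)%:C%C :> R[i] by rewrite (@ltcR R).
  apply: filterS (h _ s0') => n /=.
  rewrite norm_lt_nsq// sqr_sqrtr ?(ltW e0)// nsqBC sub0r normrN.
  by rewrite ger0_norm ?nsq_ge0.
have [r r0 ->] := gtc0_real e0.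
have r20 : 0 < r ^+ 2 by rewrite exprn_gt0.
apply: filterS (h _ r20) => n /=.
by rewrite norm_lt_nsq// nsqBC sub0r normrN ger0_norm ?nsq_ge0.
Qed.

Lemma closure_nsqP (M : set H) x :
  closure M x <-> forall e : R, 0 < e -> exists2 y, M y & nsq (x - y) < e.
Proof.
split=> [cl e e0|h B].
  have s0 : 0 < Num.sqrt e by rewrite sqrtr_gt0.
  have s0' : 0 < (Num.sqrt e)%:C%C :> R[i] by rewrite (@ltcR R).
  have [y [My]] := cl _ (nbhsx_ballx x _ s0').
  rewrite -ball_normE /= norm_lt_nsq// sqr_sqrtr ?(ltW e0)// => ?.
  by exists y.
move=> /nbhs_ballP[e /= e0]; have [r r0 ->] := gtc0_real e0 => hB.
have [y My yr] := h (r ^+ 2) (exprn_gt0 _ r0).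
by exists y; split=> //; apply: hB; rewrite -ball_normE /= norm_lt_nsq.
Qed.

Lemma closed_nsq (M : set H) x : closed M ->
  (forall e : R, 0 < e -> exists2 y, M y & nsq (x - y) < e) -> M x.
Proof. by move=> clM /closure_nsqP/clM. Qed.

Lemma cauchy_nsq_cvg (u : nat -> H) :
  (forall e : R, 0 < e -> exists N, forall m n, (N <= m)%N -> (N <= n)%N ->
     nsq (u m - u n) < e) ->
  exists l : H, u @ \oo --> l.
Proof.
move=> h; suff /cvg_ex : cvg (u @ \oo) by [].
apply/cauchy_cvgP/cauchy_exP => e e0; have [r r0 ->] := gtc0_real e0.
have [N hN] := h (r ^+ 2) (exprn_gt0 _ r0).
exists (u N), N => // n /= Nn.
by rewrite -ball_normE /= norm_lt_nsq// hN.
Qed.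

Lemma cvg_rdotl (u : nat -> H) l w :
  u @ \oo --> l -> rdot (u n) w @[n --> \oo] --> rdot l w.
Proof.
move=> /cvg_nsqP ul; apply/cvgrPdist_lt => e e0.
have k0 : 0 < nsq w + 1 by have := nsq_ge0 w; lra.
move/cvgrPdist_lt : ul => /(_ (e ^+ 2 / (nsq w + 1))).
move=> /(_ (divr_gt0 (exprn_gt0 _ e0) k0)).
apply: filterS => n /=; rewrite sub0r normrN ger0_norm ?nsq_ge0// nsqBC.
rewrite ltr_pdivlMr// -rdotBl => h.
have := cauchy_schwarz (l - u n) w; have := nsq_ge0 (l - u n) => ? ?.
rewrite -(ltr_sqr (x := `|_|)) ?nnegrE ?(ltW e0)// real_normK ?num_real//.
nra.
Qed.

Lemma cvg_nsq (u : nat -> H) l :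
  u @ \oo --> l -> nsq (u n) @[n --> \oo] --> nsq l.
Proof.
move=> ul; have -> : (fun n => nsq (u n)) =
    (fun n => nsq (u n - l) + 2 * rdot (u n) l - nsq l).
  by apply/funext => n; rewrite nsqB; lra.
rewrite [X in _ --> X](_ : _ = 0 + 2 * rdot l l - nsq l); last first.
  by rewrite /nsq; lra.
apply: cvgB; last exact: cvg_cst.
apply: cvgD; first exact/cvg_nsqP.
by apply: cvgM; [exact: cvg_cst|exact: cvg_rdotl].
Qed.

Lemma cvg0_nsq_le (u v : nat -> H) :
  (forall n, nsq (u n) <= nsq (v n)) ->
  v @ \oo --> (0 : H) -> u @ \oo --> (0 : H).
Proof.
move=> h /cvg_nsq; rewrite nsq0 => v0; apply/cvg_nsqP.
apply: (@squeeze_cvgr _ _ _ _ (fun=> 0) (fun n => nsq (v n))) => //.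
- by near=> n; rewrite subr0 nsq_ge0 h.
- exact: cvg_cst.
Unshelve. all: by end_near. Qed.

End RealInnerProduct.


(** * Closed subspaces, orthogonal projections and adjoints *)

Section Projection.
Variables (R : realType) (H : hilbertType R).
Implicit Types (x y z : H) (M N : set H) (T S : H -> H).

Definition linear_subspace M : Prop :=
  M 0 /\ forall (a : R[i]) x y, M x -> M y -> M (a *: x + y).

Lemma closed_subspace_linear M : closed_subspace M -> linear_subspace M.
Proof. by case. Qed.

Lemma subspaceD M x y : linear_subspace M -> M x -> M y -> M (x + y).
Proof. by case=> _ h Mx My; have := h 1 _ _ Mx My; rewrite scale1r. Qed.

Lemma subspaceZ M a x : linear_subspace M -> M x -> M (a *: x).
Proof. by case=> M0 h Mx; have := h a _ _ Mx M0; rewrite addr0. Qed.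

Lemma subspaceB M x y : linear_subspace M -> M x -> M y -> M (x - y).
Proof.
by move=> sM Mx My; rewrite -scaleN1r; apply: subspaceD => //; exact: subspaceZ.
Qed.

Lemma closed_subspace_setT : closed_subspace [set: H].
Proof. by split=> //; exact: closedT. Qed.

Lemma closed_subspace_setI M N :
  closed_subspace M -> closed_subspace N -> closed_subspace (M `&` N).
Proof.
move=> [cM M0 hM] [cN N0 hN]; split=> //; first exact: closedI.
by move=> a x y [Mx Nx] [My Ny]; split; [exact: hM|exact: hN].
Qed.

Lemma linear_onD M T x y : linear_on M T -> M x -> M y -> T (x + y) = T x + T y.
Proof. by move=> lT Mx My; rewrite -[x]scale1r lT// !scale1r. Qed.

Lemma linear_on0 M T : linear_subspace M -> linear_on M T -> T 0 = 0.
Proof.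
move=> [M0 _] /(linear_onD (x := 0) (y := 0)) /(_ M0 M0).
by rewrite addr0 => /esym/(canRL (addrK _)); rewrite subrr.
Qed.

Lemma linear_onZ M T a x :
  linear_subspace M -> linear_on M T -> M x -> T (a *: x) = a *: T x.
Proof.
move=> sM lT Mx; have [M0 _] := sM.
by rewrite -[a *: x]addr0 lT// (linear_on0 sM lT) addr0.
Qed.

Lemma linear_onB M T x y :
  linear_subspace M -> linear_on M T -> M x -> M y -> T (x - y) = T x - T y.
Proof.
by move=> sM lT Mx My; rewrite addrC -scaleN1r lT// scaleN1r addrC.
Qed.

(** A complex subspace contains i z along with z, so real orthogonality to it is
    orthogonality. *)
Lemma subspace_hdot_eq0 M x : linear_subspace M ->
  (forall z, M z -> hdot x z = 0) <-> (forall z, M z -> rdot x z = 0).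
Proof.
move=> sM; split=> h z Mz; first by rewrite /rdot h.
have -> : 0 = hdot (0 : H) z by rewrite linear0l.
apply/hdot_eqP; rewrite !rdot0l; split; apply: h => //.
exact: subspaceZ.
Qed.

Lemma quadratic_discriminant (a b c : R) : 0 <= a -> 0 <= c ->
  (forall t, 0 <= t ^+ 2 * a + 2 * (t * b) + c) -> b ^+ 2 <= c * a.
Proof.
rewrite le_eqVlt => /predU1P[<-|a0] c0 h.
  have [->|b0] := eqVneq b 0; first by rewrite expr0n mulr0.
  (* The polynomial is affine; at this t it takes the value - c - 2. *)
  by have := h (- (c + 1) / b); rewrite mulr0 add0r divfK//; lra.
have := h (- (b / a)); rewrite sqrrN exprMn exprVn => {}h.
have e : (b ^+ 2 * (a ^+ 2)^-1) * a + 2 * (- (b / a) * b) + c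
       = (c * a - b ^+ 2) / a by field; rewrite gt_eqF.
by move: h; rewrite e pmulr_lge0 ?invr_gt0// subr_ge0.
Qed.

(** Riesz representation by minimising the quadratic functional
    |x|^2 - 2 f(x): a minimising sequence is Cauchy by the parallelogram
    identity, and the first variation at its limit z says f = <., z>.  With
    f = <., y> this gives the projection of y on M, with f = <T ., y> the
    adjoint of T, and in both cases the lower bound is immediate. *)
Lemma riesz_minimisation M (f : H -> R) : closed_subspace M ->
  (forall x y, M x -> M y -> f (x + y) = f x + f y) ->
  (forall (a : R) x, M x -> f (a%:C%C *: x) = a * f x) ->
  (exists b, forall x, M x -> b <= nsq x - 2 * f x) ->
  exists2 z, M z & forall x, M x -> f x = rdot x z.
Proof.
move=> csM fD fZ [b fb]; have sM := closed_subspace_linear csM.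
have [clM M0 _] := csM.
pose J x := nsq x - 2 * f x.
have Jinf : has_inf (J @` M).
  by split; [exists (J 0), 0|exists b => _ [x Mx <-]; exact: fb].
pose m := inf (J @` M).
have mJ x : M x -> m <= J x.
  by move=> Mx; apply: ge_inf; [case: Jinf|exists x].
have /choice[u hu] : forall n : nat, exists x, M x /\ J x < m + n.+1%:R^-1.
  move=> n; have [|_ [x Mx <-] ?] := @inf_adherent R (J @` M) n.+1%:R^-1 _ Jinf.
    by rewrite invr_gt0.
  by exists x.
have Mu n : M (u n) by case: (hu n).
have Ju n : J (u n) < m + n.+1%:R^-1 by case: (hu n).
(* The parallelogram identity, with J >= m at the midpoint. *)
have u_cauchy p q : nsq (u p - u q) <= 2 * (p.+1%:R^-1 + q.+1%:R^-1).
  have Mpq := subspaceD sM (Mu p) (Mu q).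
  have := mJ _ (subspaceZ (2^-1)%:C%C sM Mpq).
  rewrite /J nsqZ fZ// fD// nsqD.
  have := Ju p; have := Ju q; rewrite /J nsqB expr2.
  move: p.+1%:R^-1 q.+1%:R^-1 => a c; lra.
have [e e0|z uz] := @cauchy_nsq_cvg R H u.
  have [N _ hN] := near_infty_natSinv_lt (PosNum (divr_gt0 e0 (ltr0n R 4))).
  exists N => p q Np Nq; apply: le_lt_trans (u_cauchy p q) _.
  have := hN _ Np; have := hN _ Nq => /=; move: p.+1%:R^-1 q.+1%:R^-1 => a c; lra.
have Mz : M z by apply: (closed_cvg M clM _ _ uz); near=> n; exact: Mu.
exists z => // w Mw.
(* J (u_n + t w) >= m >= J (u_n) - 1/(n+1) for all real t. *)
have var n : (rdot (u n) w - f w) ^+ 2 <= n.+1%:R^-1 * nsq w.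
  apply: quadratic_discriminant; rewrite ?nsq_ge0// => t.
  have Mtw := subspaceZ t%:C%C sM Mw.
  have := mJ _ (subspaceD sM (Mu n) Mtw).
  rewrite /J nsqD nsqZ fD// fZ// rdotZr.
  by have := Ju n; rewrite /J; move: n.+1%:R^-1 => c; lra.
have lim0 : (rdot (u n) w - f w) ^+ 2 @[n --> \oo] --> 0.
  apply: (@squeeze_cvgr _ _ _ _ (fun=> 0) (fun n => n.+1%:R^-1 * nsq w)).
  - by near=> n; rewrite sqr_ge0 var.
  - exact: cvg_cst.
  - by rewrite -(mul0r (nsq w)); apply: cvgM; [exact: cvg_harmonic|exact: cvg_cst].
have limz : (rdot (u n) w - f w) ^+ 2 @[n --> \oo] --> (rdot z w - f w) ^+ 2.
  have c : rdot (u n) w - f w @[n --> \oo] --> rdot z w - f w.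
    by apply: cvgB; [exact: cvg_rdotl|exact: cvg_cst].
  by rewrite expr2; under eq_fun do rewrite expr2; exact: cvgM.
have : (rdot z w - f w) ^+ 2 = 0 by exact: (cvg_unique _ limz lim0).
by move=> /eqP; rewrite sqrf_eq0 subr_eq0 => /eqP <-; rewrite rdotC.
Unshelve. all: by end_near. Qed.

Lemma orth_projP M x : closed_subspace M ->
  M (orth_proj M x) /\ forall z, M z -> rdot (x - orth_proj M x) z = 0.
Proof.
move=> csM; have sM := closed_subspace_linear csM.
have [||| y My hy] := @riesz_minimisation M (fun w => rdot w x) csM.
- by move=> *; rewrite rdotDl.
- by move=> *; rewrite rdotZl.
- exists (- nsq x) => w _; have := nsq_ge0 (w - x); rewrite nsqB; lra.
rewrite -(subspace_hdot_eq0 _ sM).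
apply: (@xgetPex _ 0 [set y | M y /\ forall z, M z -> hdot (x - y) z = 0]).
exists y; split=> //; apply/subspace_hdot_eq0 => // z Mz.
by rewrite rdotBl (rdotC x) hy// (rdotC y) subrr.
Qed.

Lemma orth_proj_in M x : closed_subspace M -> M (orth_proj M x).
Proof. by case/(orth_projP x). Qed.

Lemma orth_proj_rdot M x z : closed_subspace M -> M z ->
  rdot (orth_proj M x) z = rdot x z.
Proof.
by case/(orth_projP x) => _ h /h /eqP; rewrite rdotBl subr_eq0 => /eqP.
Qed.

Lemma rdot_inj M x y : linear_subspace M -> M x -> M y ->
  (forall z, M z -> rdot x z = rdot y z) -> x = y.
Proof.
move=> sM Mx My h; apply/eqP; rewrite -subr_eq0; apply/eqP/nsq_eq0.
by rewrite /nsq rdotBl h ?subrr//; exact: subspaceB.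
Qed.

Lemma orth_proj_unique M x y : closed_subspace M -> M y ->
  (forall z, M z -> rdot x z = rdot y z) -> orth_proj M x = y.
Proof.
move=> csM My h; apply: (rdot_inj (closed_subspace_linear csM)) => //.
  exact: orth_proj_in.
by move=> z Mz; rewrite orth_proj_rdot// h.
Qed.

Lemma orth_proj_id M x : closed_subspace M -> M x -> orth_proj M x = x.
Proof. by move=> csM Mx; apply: orth_proj_unique. Qed.

Lemma orth_proj_linear M N : closed_subspace M -> linear_on N (orth_proj M).
Proof.
move=> csM a x y _ _; have sM := closed_subspace_linear csM.
have Px := orth_proj_in x csM; have Py := orth_proj_in y csM.
apply: orth_proj_unique => //; first by case: sM => _; apply.
move=> z Mz; rewrite !rdotDl (orth_proj_rdot y)//; congr (_ + _).
have e w : rdot (a *: w) z = rdot w (a^*%C *: z).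
  rewrite /rdot linearZl_LR linearZr_LR /=.
  case: (a) (hdot w z) => ? ? [? ?] /=; ring.
by rewrite !e orth_proj_rdot//; exact: subspaceZ.
Qed.

Lemma nsq_orth_proj M x : closed_subspace M ->
  nsq x = nsq (orth_proj M x) + nsq (x - orth_proj M x).
Proof.
move=> csM; have [Px h] := orth_projP x csM.
by rewrite nsqB -(orth_proj_rdot x csM Px) /nsq; ring.
Qed.

Lemma orth_proj_le M x : closed_subspace M -> nsq (orth_proj M x) <= nsq x.
Proof. by move=> csM; rewrite (nsq_orth_proj x csM) lerDl nsq_ge0. Qed.

Lemma orth_proj_isom M x : closed_subspace M ->
  nsq x <= nsq (orth_proj M x) -> orth_proj M x = x.
Proof.
move=> csM; rewrite (nsq_orth_proj x csM) -subr_ge0 opprD addNKr oppr_ge0.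
move=> h; have /nsq_eq0/eqP : nsq (x - orth_proj M x) = 0.
  by apply/eqP; rewrite eq_le h nsq_ge0.
by rewrite subr_eq0 => /eqP.
Qed.

Lemma orth_proj_sub M N x : closed_subspace M -> closed_subspace N ->
  N `<=` M -> orth_proj N (orth_proj M x) = orth_proj N x.
Proof.
move=> csM csN NM; apply: orth_proj_unique => //; first exact: orth_proj_in.
by move=> z Nz; rewrite !orth_proj_rdot//; exact: NM.
Qed.

Lemma contraction_nsq M T x : contraction_op M T -> M x -> nsq (T x) <= nsq x.
Proof. by move=> [_ _ h] /h; rewrite ler_nsq. Qed.

Lemma contraction_opP M T : contraction_op M T <->
  [/\ set_fun M M T, linear_on M T & forall x, M x -> nsq (T x) <= nsq x].
Proof. by split=> -[? ? h]; split=> // x /h; rewrite ler_nsq. Qed.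

(** Adjoints for the complex and for the real inner product agree, again because
    M is stable under multiplication by i. *)
Lemma hdot_adjointP M T y z : linear_subspace M -> linear_on M T ->
  (forall x, M x -> hdot (T x) y = hdot x z) <->
  (forall x, M x -> rdot (T x) y = rdot x z).
Proof.
move=> sM lT; split=> h x Mx; first by rewrite /rdot h.
apply/hdot_eqP; split; first exact: h.
apply: oppr_inj; rewrite -!rdot_imull -h; last exact: subspaceZ.
by rewrite /imul (linear_onZ _ sM lT).
Qed.

Lemma adjointP M T y : closed_subspace M -> contraction_op M T ->
  M (adjoint M T y) /\ forall x, M x -> rdot (T x) y = rdot x (adjoint M T y).
Proof.
move=> csM cT; have sM := closed_subspace_linear csM; have [TM lT _] := cT.
rewrite -hdot_adjointP//.
have [||| z Mz hz] := @riesz_minimisation M (fun w => rdot (T w) y) csM.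
- by move=> u v Mu Mv; rewrite (linear_onD lT)// rdotDl.
- by move=> a u Mu; rewrite (linear_onZ _ sM lT)// rdotZl.
- exists (- nsq y) => w Mw; have := nsq_ge0 (T w - y); rewrite nsqB.
  have := contraction_nsq cT Mw; lra.
apply: (@xgetPex _ 0
  [set z | M z /\ forall x, M x -> hdot (T x) y = hdot x z]).
by exists z; split=> //; apply/hdot_adjointP.
Qed.

Lemma adjoint_in M T y : closed_subspace M -> contraction_op M T ->
  M (adjoint M T y).
Proof. by move=> csM cT; case: (adjointP y csM cT). Qed.

Lemma adjoint_rdot M T x y : closed_subspace M -> contraction_op M T -> M x ->
  rdot x (adjoint M T y) = rdot (T x) y.
Proof. by move=> csM cT Mx; case: (adjointP y csM cT) => _ ->. Qed.

Lemma adjoint_hdot M T x y : closed_subspace M -> contraction_op M T -> M x ->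
  hdot (T x) y = hdot x (adjoint M T y).
Proof.
move=> csM cT; move: x; have [_ lT _] := cT.
apply/hdot_adjointP => //; first exact: closed_subspace_linear.
by move=> x Mx; rewrite adjoint_rdot.
Qed.

Lemma adjoint_unique M T y z : closed_subspace M -> contraction_op M T ->
  M z -> (forall x, M x -> rdot (T x) y = rdot x z) -> adjoint M T y = z.
Proof.
move=> csM cT Mz h; apply: (rdot_inj (closed_subspace_linear csM)) => //.
  exact: adjoint_in.
by move=> x Mx; rewrite rdotC adjoint_rdot// h// rdotC.
Qed.

Lemma adjoint_contraction M T : closed_subspace M -> contraction_op M T ->
  contraction_op M (adjoint M T).
Proof.
move=> csM cT; have sM := closed_subspace_linear csM; have [TM lT _] := cT.
apply/contraction_opP; split.
- by move=> y _; exact: adjoint_in.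
- move=> a x y Mx My; have [Ax Ay] := (adjoint_in x csM cT, adjoint_in y csM cT).
  apply: adjoint_unique => //; first by case: sM => _; apply.
  apply/hdot_adjointP => // z Mz; rewrite !linearDr !linearZr_LR /=.
  by congr (_ * _ + _); apply: adjoint_hdot.
- move=> y My; set z := adjoint M T y.
  have Mz : M z by exact: adjoint_in.
  have := cauchy_schwarz (T z) y; rewrite -(adjoint_rdot y csM cT Mz) -/z -/(nsq z).
  have := contraction_nsq cT Mz; have := nsq_ge0 y; have := nsq_ge0 z.
  have := nsq_ge0 (T z); nra.
Qed.

Lemma adjoint_rdotl M T x y : closed_subspace M -> contraction_op M T -> M x ->
  rdot (adjoint M T y) x = rdot y (T x).
Proof. by move=> csM cT Mx; rewrite rdotC adjoint_rdot// rdotC. Qed.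

Lemma adjointK M T x : closed_subspace M -> contraction_op M T -> M x ->
  adjoint M (adjoint M T) x = T x.
Proof.
move=> csM cT Mx; have [TM _ _] := cT.
apply: adjoint_unique => //; first exact: adjoint_contraction; first exact: TM.
by move=> y My; rewrite adjoint_rdotl.
Qed.

(** A vector whose norm T preserves is fixed by T^* T; this is the equality case
    of |x - T^*T x|^2 = |x|^2 - 2 |T x|^2 + |T^*T x|^2 <= |x|^2 - |T x|^2. *)
Lemma adjoint_isomK M T x : closed_subspace M -> contraction_op M T -> M x ->
  nsq (T x) = nsq x -> adjoint M T (T x) = x.
Proof.
move=> csM cT Mx e; have [TM _ _] := cT.
suff /nsq_eq0/eqP : nsq (x - adjoint M T (T x)) = 0.
  by rewrite subr_eq0 => /eqP.
apply/eqP; rewrite eq_le nsq_ge0 andbT nsqB adjoint_rdot// -/(nsq (T x)).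
have := contraction_nsq (adjoint_contraction csM cT) (TM _ Mx); lra.
Qed.

Lemma contraction_iter M T n : contraction_op M T -> contraction_op M (iter n T).
Proof.
move=> /contraction_opP[TM lT h]; apply/contraction_opP.
elim: n => [|n [TMn lTn hn]] /=; first by split.
split=> [x Mx|a x y Mx My|x Mx]; first exact/TM/TMn.
  by rewrite /= lTn// lT//; exact: TMn.
by apply: le_trans (h _ _) (hn _ Mx); exact: TMn.
Qed.

Lemma iter_ext M T S n x : set_fun M M S -> (forall x, M x -> T x = S x) ->
  M x -> iter n T x = iter n S x.
Proof.
move=> SM e Mx; have Sn k : M (iter k S x) by elim: k => //= k; exact: SM.
by elim: n => //= n ->; exact: e.
Qed.

End Projection.


(** * The positive square root of I - C *)

Section SquareRoot.
Variables (R : realType) (H : hilbertType R).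
Implicit Types (x y z : H) (M N : set H) (S T : H -> H) (a b : R).

Definition self_adjoint M T : Prop :=
  forall x y, M x -> M y -> rdot (T x) y = rdot x (T y).

Section Iteration.
Variables (M : set H) (C : H -> H).
Hypotheses (csM : closed_subspace M) (cC : contraction_op M C).
Hypothesis saC : self_adjoint M C.

Let sM : linear_subspace M := closed_subspace_linear csM.

(** The values at C of the polynomials p with nonnegative coefficients and no
    constant term, indexed by p(1), which bounds the norm of p(C). *)
Inductive poly_cone : R -> (H -> H) -> Prop :=
| poly_cone0 : poly_cone 0 (fun=> 0)
| poly_coneX : poly_cone 1 C
| poly_coneD a b S T : poly_cone a S -> poly_cone b T ->
    poly_cone (a + b) (fun x => S x + T x)
| poly_coneM a b S T : poly_cone a S -> poly_cone b T ->
    poly_cone (a * b) (fun x => S (T x))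
| poly_cone_half a S : poly_cone a S ->
    poly_cone (2^-1 * a) (fun x => (2^-1)%:C%C *: S x).

Lemma poly_cone_ge0 a S : poly_cone a S -> 0 <= a.
Proof.
by elim=> {a S} // *; rewrite ?addr_ge0 ?mulr_ge0 ?invr_ge0.
Qed.

Lemma poly_cone_op a S : poly_cone a S -> set_fun M M S /\ linear_on M S.
Proof.
elim=> {a S}.
- split=> [x _|b x y _ _]; first by case: sM.
  by rewrite scaler0 addr0.
- by case: cC.
- move=> a b S T _ [SM lS] _ [TM lT]; split=> [x Mx|c x y Mx My].
    by apply: subspaceD; [|exact: SM|exact: TM].
  by rewrite lS// lT// scalerDr addrACA.
- move=> a b S T _ [SM lS] _ [TM lT]; split=> [x Mx|c x y Mx My].
    exact/SM/TM.
  by rewrite lT// lS//; exact: TM.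
- move=> a S _ [SM lS]; split=> [x Mx|c x y Mx My].
    by apply: subspaceZ => //; exact: SM.
  by rewrite lS// scalerDr !scalerA mulrC.
Qed.

Lemma poly_cone_nsq a S x : poly_cone a S -> M x -> nsq (S x) <= a ^+ 2 * nsq x.
Proof.
move=> cS; elim: cS x => {a S}.
- by move=> x _; rewrite nsq0 expr0n mul0r.
- by move=> x Mx; rewrite expr1n mul1r; exact: (contraction_nsq cC).
- move=> a b S T cS hS cT hT x Mx.
  have := cauchy_schwarz (S x) (T x); have := hS _ Mx; have := hT _ Mx.
  have a0 := poly_cone_ge0 cS; have b0 := poly_cone_ge0 cT.
  have := nsq_ge0 x; have := nsq_ge0 (S x); have := nsq_ge0 (T x).
  rewrite nsqD; move: (nsq x) (nsq (S x)) (nsq (T x)) (rdot _ _) => X P Q r.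
  move=> Q0 P0 X0 hQ hP hr.
  have abX : 0 <= a * b * X by rewrite !mulr_ge0.
  have : r <= a * b * X.
    rewrite real_leNgt ?num_real//; apply/negP => lt.
    have : (a * b * X) ^+ 2 < r ^+ 2.
      by rewrite ltr_pXn2r ?nnegrE ?(ltW (le_lt_trans _ lt)).
    by have := ler_pM P0 Q0 hP hQ; nra.
  nra.
- move=> a b S T cS hS cT hT x Mx; have [TM _] := poly_cone_op cT.
  apply: le_trans (hS _ (TM _ Mx)) _; rewrite exprMn -[leRHS]mulrA.
  by rewrite ler_wpM2l ?sqr_ge0// hT.
- move=> a S cS hS x Mx; rewrite nsqZ exprMn -[leRHS]mulrA.
  by rewrite ler_wpM2l ?sqr_ge0// hS.
Qed.

Lemma poly_cone_commute_with T a S x : set_fun M M T -> linear_on M T ->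
  (forall x, M x -> T (C x) = C (T x)) ->
  poly_cone a S -> M x -> T (S x) = S (T x).
Proof.
move=> TM lT TC cS; elim: cS x => {a S}.
- by move=> x _; rewrite (linear_on0 sM lT).
- exact: TC.
- move=> a b S U cS hS cU hU x Mx.
  have [[SM _] [UM _]] := (poly_cone_op cS, poly_cone_op cU).
  by rewrite (linear_onD lT) ?hS ?hU//; [exact: SM|exact: UM].
- move=> a b S U cS hS cU hU x Mx; have [UM _] := poly_cone_op cU.
  by rewrite hS ?hU//; exact: UM.
- move=> a S cS hS x Mx; have [SM _] := poly_cone_op cS.
  by rewrite (linear_onZ _ sM lT) ?hS//; exact: SM.
Qed.

Lemma poly_cone_commute a b S T x : poly_cone a S -> poly_cone b T -> M x ->
  T (S x) = S (T x).
Proof.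
move=> cS cT; have [[SM lS] [TM lT]] := (poly_cone_op cS, poly_cone_op cT).
apply: poly_cone_commute_with cS => // y My.
have [CM lC _] := cC.
by apply/esym; apply: poly_cone_commute_with cT _.
Qed.

Lemma poly_cone_self_adjoint a S : poly_cone a S -> self_adjoint M S.
Proof.
elim=> {a S} //.
- by move=> x y _ _; rewrite rdot0l rdot0r.
- by move=> a b S T _ hS _ hT x y Mx My; rewrite rdotDl rdotDr hS// hT.
- move=> a b S T cS hS cT hT x y Mx My.
  have [[SM _] [TM _]] := (poly_cone_op cS, poly_cone_op cT).
  by rewrite hS ?hT//; [rewrite (poly_cone_commute cS cT)|exact: SM|exact: TM].
- by move=> a S _ hS x y Mx My; rewrite rdotZl rdotZr hS.
Qed.

(** If S = I - Y, then S^2 = I - C means Y = (C + Y^2) / 2; the square root is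
    found by iterating this equation from 0. *)
Fixpoint sqrt_iter n : H -> H :=
  if n is k.+1 then fun x => (2^-1)%:C%C *: (C x + sqrt_iter k (sqrt_iter k x))
  else fun=> 0.

(** The same iteration for the number 1 in place of C, that is, the value at 1 of
    the polynomial in C which [sqrt_iter n] is. *)
Fixpoint sqrt_iter1 n : R :=
  if n is k.+1 then 2^-1 * (1 + sqrt_iter1 k * sqrt_iter1 k) else 0.

Lemma sqrt_iter_cone n : poly_cone (sqrt_iter1 n) (sqrt_iter n).
Proof.
elim: n => [|n IH] /=; first exact: poly_cone0.
apply: poly_cone_half; apply: poly_coneD; first exact: poly_coneX.
exact: poly_coneM.
Qed.

(** The cone is there for the increments: they
    stay in it, by Y_(n+2) - Y_(n+1) = (Y_(n+1) - Y_n)(Y_(n+1) + Y_n)/2, so their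
    norms are bounded by the increments of a bounded monotone real sequence. *)
Lemma sqrt_iterS_cone n : exists2 D, poly_cone (sqrt_iter1 n.+1 - sqrt_iter1 n) D &
  forall x, M x -> sqrt_iter n.+1 x - sqrt_iter n x = D x.
Proof.
elim: n => [|n [D cD hD]].
  exists (sqrt_iter 1); last by move=> x _; rewrite subr0.
  by rewrite subr0; exact: sqrt_iter_cone.
have [cY cY1] := (sqrt_iter_cone n, sqrt_iter_cone n.+1).
have [[YM lY] [Y1M lY1]] := (poly_cone_op cY, poly_cone_op cY1).
exists (fun x => (2^-1)%:C%C *: D (sqrt_iter n.+1 x + sqrt_iter n x)).
  rewrite [X in poly_cone X](_ : _ = 2^-1 * ((sqrt_iter1 n.+1 - sqrt_iter1 n) *
      (sqrt_iter1 n.+1 + sqrt_iter1 n))); last by rewrite /=; ring.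
  apply: (@poly_cone_half _ (fun x => D (_ x + _ x))).
  by apply: (@poly_coneM _ _ _ (fun x => _ x + _ x)) => //; exact: poly_coneD.
move=> x Mx; have [MY MY1] := (YM _ Mx, Y1M _ Mx).
rewrite -hD; last exact: subspaceD.
rewrite (linear_onD lY)// (linear_onD lY1)//.
transitivity ((2^-1)%:C%C *: (C x + sqrt_iter n.+1 (sqrt_iter n.+1 x)) -
  (2^-1)%:C%C *: (C x + sqrt_iter n (sqrt_iter n x))); first by [].
rewrite -scalerBr (poly_cone_commute cY cY1 Mx); congr (_ *: _).
move: (C x) (sqrt_iter n.+1 (sqrt_iter n.+1 x)) (sqrt_iter n (sqrt_iter n x)).
move: (sqrt_iter n (sqrt_iter n.+1 x)) => u v w z.
by rewrite opprD addrACA subrr add0r opprD addrA addrK.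
Qed.

Lemma sqrt_iter_diff_cone m n : (n <= m)%N ->
  exists2 D, poly_cone (sqrt_iter1 m - sqrt_iter1 n) D &
    forall x, M x -> sqrt_iter m x - sqrt_iter n x = D x.
Proof.
move=> /subnKC <-; elim: (m - n)%N => [|k [D cD hD]].
  rewrite addn0; exists (fun=> 0); first by rewrite subrr; exact: poly_cone0.
  by move=> x _; rewrite subrr.
have [E cE hE] := sqrt_iterS_cone (n + k).
exists (fun x => E x + D x).
  rewrite addnS (_ : _ - _ = (sqrt_iter1 (n + k).+1 - sqrt_iter1 (n + k)) +
    (sqrt_iter1 (n + k) - sqrt_iter1 n)); first exact: poly_coneD.
  by rewrite addrA subrK.
by move=> x Mx; rewrite addnS -hE// -hD// addrA subrK.
Qed.

Lemma sqrt_iter1_ndecr : nondecreasing_seq sqrt_iter1.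
Proof.
move=> n m /sqrt_iter_diff_cone[D /poly_cone_ge0 h _].
by rewrite -subr_ge0.
Qed.

Lemma sqrt_iter1_le1 n : sqrt_iter1 n <= 1.
Proof.
elim: n => [|n IH] //=; have := poly_cone_ge0 (sqrt_iter_cone n); nra.
Qed.

Lemma sqrt_iter_cvg x : M x -> exists l : H, (fun n => sqrt_iter n x) @ \oo --> l.
Proof.
move=> Mx; apply: cauchy_nsq_cvg => e e0.
have /cvg_ex[y yl] : cvg (sqrt_iter1 @ \oo).
  apply: nondecreasing_is_cvgn; first exact: sqrt_iter1_ndecr.
  by exists 1 => _ [n _ <-]; exact: sqrt_iter1_le1.
have k0 : 0 < nsq x + 1 by have := nsq_ge0 x; lra.
have d0 : 0 < Num.sqrt (e / (nsq x + 1)) by rewrite sqrtr_gt0 divr_gt0.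
set d := Num.sqrt _ in d0.
have dE : d ^+ 2 * (nsq x + 1) = e.
  by rewrite sqr_sqrtr ?divfK ?gt_eqF// ltW// divr_gt0.
have /cvgrPdist_lt/(_ d d0)[N _ hN] := yl.
have yle n : sqrt_iter1 n <= y.
  rewrite -(cvg_lim (@Rhausdorff R) yl).
  by apply: nondecreasing_cvgn_le; [exact: sqrt_iter1_ndecr|apply/cvg_ex; exists y].
have main m n : (N <= n)%N -> (n <= m)%N ->
    nsq (sqrt_iter m x - sqrt_iter n x) < e.
  move=> Nn nm; have [D cD ->//] := sqrt_iter_diff_cone nm.
  apply: le_lt_trans (poly_cone_nsq cD Mx) _; rewrite -dE.
  have := hN _ Nn => /=; rewrite ger0_norm ?subr_ge0// => lt.
  have := yle m; have := nsq_ge0 x; have := poly_cone_ge0 cD.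
  move: (sqrt_iter1 m) (sqrt_iter1 n) (nsq x) lt => p q X lt pq X0 py.
  have : (p - q) ^+ 2 <= d ^+ 2 by nra.
  have : 0 < d ^+ 2 by rewrite exprn_gt0.
  nra.
exists N => m n Nm Nn; have [nm|mn] := leqP n m; first exact: main.
by rewrite nsqBC main// ltnW.
Qed.

Lemma cvgH_unique (u : nat -> H) (l k : H) :
  u @ \oo --> l -> u @ \oo --> k -> l = k.
Proof. by move=> ul uk; exact: (cvg_unique (@norm_hausdorff _ _) ul uk). Qed.

(** The iterates converge at each vector, and each of these properties passes to
    the limit. *)
Lemma sqrt_limit : exists Y : H -> H,
  [/\ set_fun M M Y, linear_on M Y, self_adjoint M Y,
      forall x, M x -> nsq (Y x) <= nsq x &
      forall x, M x -> Y x = (2^-1)%:C%C *: (C x + Y (Y x))].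
Proof.
have /choice[Y hY] : forall x, exists l : H,
    M x -> (fun n => sqrt_iter n x) @ \oo --> l.
  move=> x; have [/sqrt_iter_cvg[l]|nMx] := pselect (M x); first by exists l.
  by exists 0.
have Yn n := poly_cone_op (sqrt_iter_cone n).
have [clM M0 _] := csM.
have YnM n x : M x -> M (sqrt_iter n x) by case: (Yn n) => + _; apply.
have YM : set_fun M M Y.
  move=> x Mx; apply: (closed_cvg M clM _ _ (hY _ Mx)).
  by near=> n; exact: YnM.
have Yn_le n x : M x -> nsq (sqrt_iter n x) <= nsq x.
  move=> Mx; apply: le_trans (poly_cone_nsq (sqrt_iter_cone n) Mx) _.
  have := sqrt_iter1_le1 n; have := poly_cone_ge0 (sqrt_iter_cone n).
  have := nsq_ge0 x; move: (nsq x) (sqrt_iter1 n) => X p X0 p0 p1.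
  have : p ^+ 2 <= 1 by nra.
  nra.
exists Y; split=> // [a x y Mx My|x y Mx My|x Mx|x Mx].
- have Mxy : M (a *: x + y) by case: sM => _; apply.
  apply: cvgH_unique (hY _ Mxy) _.
  under eq_fun do rewrite (proj2 (Yn _))//.
  by apply: cvgD; [apply: cvgZl_tmp|]; exact: hY.
- have h1 := cvg_rdotl (w := y) (hY _ Mx).
  have h2 := cvg_rdotl (w := x) (hY _ My).
  rewrite (rdotC x); apply: (cvg_unique (@Rhausdorff R) h1).
  apply: cvg_trans h2; apply: near_eq_cvg; near=> n.
  by rewrite (poly_cone_self_adjoint (sqrt_iter_cone n))// rdotC.
- have h := cvg_nsq (hY _ Mx).
  apply: (closed_cvg [set t | t <= nsq x] (@closed_le R (nsq x)) _ _ h).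
  by near=> n; exact: Yn_le.
- have h1 : (fun n => sqrt_iter n.+1 x) @ \oo --> Y x.
    by have := hY _ Mx; rewrite -cvg_shiftS.
  apply: cvgH_unique h1 _; apply: cvgZl_tmp; apply: cvgD; first exact: cvg_cst.
  have /cvg_nsqP c1 := hY _ Mx; have /cvg_nsqP c2 := hY _ (YM _ Mx).
  apply/cvg_nsqP; apply: (@squeeze_cvgr _ _ _ _ (fun=> 0)
    (fun n => 2 * nsq (sqrt_iter n x - Y x) +
              2 * nsq (sqrt_iter n (Y x) - Y (Y x)))).
  + near=> n; rewrite nsq_ge0 /=.
    apply: le_trans (nsq_trans _ (sqrt_iter n (Y x)) _) _.
    have [Mn MY] := (YnM n _ Mx, YM _ Mx).
    rewrite -(linear_onB sM (proj2 (Yn n)))// lerD2r ler_pM2l// Yn_le//.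
    exact: subspaceB.
  + exact: cvg_cst.
  + rewrite [X in _ --> X](_ : 0 = 2 * 0 + 2 * 0); last by rewrite !mulr0 addr0.
    by apply: cvgD; apply: cvgM => //; exact: cvg_cst.
Unshelve. all: by end_near. Qed.

End Iteration.

(** The operator I - Y, where Y = lim Y_n solves Y = (C + Y^2)/2, is a square
    root of I - C; it is positive since Y is a self-adjoint contraction. *)
Lemma sqrt_exists M C : closed_subspace M -> contraction_op M C ->
  self_adjoint M C ->
  exists S, [/\ bounded_op M S, positive_op M S &
                forall x, M x -> S (S x) = x - C x].
Proof.
move=> csM cC saC; have sM := closed_subspace_linear csM.
have [Y [YM lY saY nY eY]] := sqrt_limit csM cC saC.
have SM x : M x -> M (x - Y x) by move=> Mx; apply: subspaceB => //; exact: YM.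
have lS : linear_on M (fun x => x - Y x).
  by move=> a x y Mx My; rewrite lY// scalerBr opprD addrACA.
exists (fun x => x - Y x); split.
- split=> //; exists 2 => x Mx; apply: le_trans (ler_normB _ _) _.
  by rewrite mulrDl mul1r lerD2l ler_nsq nY.
- move=> x Mx; rewrite lecE /= Im_hdot; apply/andP; split.
    have saS : rdot (x - Y x) (imul x) = rdot x (imul (x - Y x)).
      have Mi : M (imul x) by exact: subspaceZ.
      rewrite rdotBl saY// -rdotBr; congr rdot.
      by rewrite /imul (linear_onZ _ sM lY)// scalerBr.
    apply/eqP; have := saS; have := rdot_imull x (x - Y x).
    rewrite (rdotC (imul x)); lra.
  rewrite -/(rdot _ _) rdotBl subr_ge0.
  have := cauchy_schwarz (Y x) x; have := nY _ Mx.
  have := nsq_ge0 x; have := nsq_ge0 (Y x); rewrite -/(nsq x).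
  move: (nsq x) (nsq (Y x)) (rdot _ _) => X Q r Q0 X0 QX hr.
  rewrite real_leNgt ?num_real//; apply/negP => lt; nra.
- move=> x Mx; have MY := YM _ Mx; rewrite (linear_onB sM lY)//.
  have e : C x = Y x + Y x - Y (Y x).
    apply/eqP; rewrite eq_sym subr_eq; apply/eqP.
    rewrite {1 2}eY// -scalerDl -rmorphD /=.
    by rewrite [X in X%:C%C](_ : _ = 1) ?scale1r//; lra.
  by rewrite e !opprD !opprK !addrA.
Qed.

End SquareRoot.


(** * Defect operators and defect spaces *)

Section Defect.
Variables (R : realType) (H : hilbertType R).
Implicit Types (x y z : H) (M N L : set H) (S T : H -> H).

(** Over the complex numbers, polarisation turns real values of <S x, x> into
    self-adjointness of S. *)
Lemma positive_self_adjoint M S : linear_subspace M -> set_fun M M S ->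
  linear_on M S -> positive_op M S -> self_adjoint M S.
Proof.
move=> sM SM lS pS.
have im0 x : M x -> rdot (S x) (imul x) = 0.
  by move=> /pS; rewrite lecE Im_hdot => /andP[/eqP].
have antisym x y : M x -> M y -> rdot (S x) (imul y) = - rdot (S y) (imul x).
  move=> Mx My; have := im0 _ (subspaceD sM Mx My).
  have [hx hy] := (im0 _ Mx, im0 _ My).
  rewrite (linear_onD lS)// {1}/imul scalerDr -!/(imul _) rdotDl !rdotDr; lra.
move=> x y Mx My; have Miy : M (imul y) by exact: subspaceZ.
have := antisym _ _ Mx Miy; rewrite imulK rdotNr.
rewrite {1}/imul (linear_onZ _ sM lS)// -/(imul (S y)) rdot_imull.
by rewrite {1}/imul -/(imul (imul x)) imulK rdotNr !opprK
  (rdotC x) => /oppr_inj.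
Qed.

Lemma defect_opP M T : closed_subspace M -> contraction_op M T ->
  [/\ bounded_op M (defect_op M T), positive_op M (defect_op M T) &
      forall x, M x ->
        defect_op M T (defect_op M T x) = x - adjoint M T (T x)].
Proof.
move=> csM cT; have [TM lT _] := cT; have cTs := adjoint_contraction csM cT.
have [TsM lTs _] := cTs.
have [||S hS] := @sqrt_exists R H M (fun x => adjoint M T (T x)) csM.
- apply/contraction_opP; split=> [x Mx|a x y Mx My|x Mx].
  + exact/TsM/TM.
  + by rewrite lT// lTs//; exact: TM.
  + apply: le_trans (contraction_nsq cT Mx).
    exact/(contraction_nsq cTs)/TM.
- by move=> x y Mx My; rewrite adjoint_rdotl// adjoint_rdot.
apply: (@xgetPex _ (fun=> 0) [set S | [/\ bounded_op M S, positive_op M S &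
   forall x, M x -> S (S x) = x - adjoint M T (T x)]]).
by exists S.
Qed.

Lemma defect_op_linear M T : closed_subspace M -> contraction_op M T ->
  set_fun M M (defect_op M T) /\ linear_on M (defect_op M T).
Proof. by move=> csM /(defect_opP csM)[[]]. Qed.

Lemma defect_self_adjoint M T : closed_subspace M -> contraction_op M T ->
  self_adjoint M (defect_op M T).
Proof.
move=> csM /(defect_opP csM)[[DM lD _] pD _].
exact: positive_self_adjoint (closed_subspace_linear csM) _ _ _.
Qed.

Lemma nsq_defect M T x : closed_subspace M -> contraction_op M T -> M x ->
  nsq (defect_op M T x) = nsq x - nsq (T x).
Proof.
move=> csM cT Mx; have [DM _] := defect_op_linear csM cT.
have [_ _ D2] := defect_opP csM cT.
rewrite {1}/nsq (defect_self_adjoint csM cT)//; last exact: DM.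
by rewrite D2// rdotBr adjoint_rdot.
Qed.

(** All the kernels of the theorem become sets of vectors on which a power of the
    operator is isometric; from here on the square root is out of the way. *)
Lemma ker_defectE M T : closed_subspace M -> contraction_op M T ->
  op_ker M (defect_op M T) = [set x | M x /\ nsq (T x) = nsq x].
Proof.
move=> csM cT; apply/seteqP; split=> x [Mx e]; split=> //.
  by have := nsq_defect csM cT Mx; rewrite e nsq0; lra.
by apply: nsq_eq0; rewrite nsq_defect// e subrr.
Qed.

Lemma ker_defect_closed M T : closed_subspace M -> contraction_op M T ->
  closed_subspace (op_ker M (defect_op M T)).
Proof.
move=> csM cT; have [DM lD] := defect_op_linear csM cT.
have [clM M0 sM'] := csM; have sM := closed_subspace_linear csM.
split=> [x /closure_nsqP cl||a x y [Mx Dx] [My Dy]].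
- have Mx : M x.
    by apply: closed_nsq clM _ => e /cl[y [My _] ?]; exists y.
  split=> //; apply/nsq_eq0/eqP; rewrite eq_le nsq_ge0 andbT.
  apply/ler_addgt0Pl => e /cl[y [My Dy]] xy; rewrite addr0.
  apply: le_trans (ltW xy); rewrite -[defect_op M T x]subr0 -Dy.
  rewrite -(linear_onB sM lD)// nsq_defect//; last exact: subspaceB.
  by rewrite gerBl nsq_ge0.
- by split=> //; exact: linear_on0 lD.
- by split; [exact: sM'|rewrite lD// Dx Dy scaler0 addr0].
Qed.

Definition ominus M L : set H :=
  [set x | M x /\ forall y, L y -> rdot x y = 0].

Lemma closure_closed_subspace N : linear_subspace N -> closed_subspace (closure N).
Proof.
move=> [N0 hN]; split; [exact: closed_closure|exact: subset_closure|].
move=> a x y /closure_nsqP cx /closure_nsqP cy; apply/closure_nsqP => e e0.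
have na0 : 0 <= complex.Re (`|a| ^+ 2).
  by rewrite -(@lecR R) RRe_real ?ger0_real ?exprn_ge0.
set k := complex.Re _ in na0.
have nsqZc z : nsq (a *: z) = k * nsq z.
  apply: (@complexI R); rewrite rmorphM /= !nsq_norm normrZ exprMn.
  by rewrite RRe_real ?ger0_real ?exprn_ge0.
have d0 : 0 < e / (4 * (k + 1)) by rewrite divr_gt0//; lra.
have d1 : 0 < e / 4 by lra.
have [u Nu xu] := cx _ d0; have [v Nv yv] := cy _ d1.
exists (a *: u + v); first exact: hN.
rewrite opprD addrACA -scalerBr; apply: le_lt_trans (nsqD_le _ _) _.
rewrite nsqZc; move: xu; rewrite ltr_pdivlMr; last by lra.
by have := nsq_ge0 (x - u); nra.
Qed.

(** The closure of a range is its double orthogonal complement.  This computes the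
    defect spaces, where the complement L of the range is the kernel, and also
    the closures of the ranges of P_(n,m) D. *)
Lemma closure_ominus M N L : closed_subspace M -> linear_subspace N ->
  N `<=` M ->
  (forall y, L y <-> M y /\ forall z, N z -> rdot y z = 0) ->
  closure N = ominus M L.
Proof.
move=> csM sN NM hL; have csN := closure_closed_subspace sN.
have [clM _ _] := csM; have sM := closed_subspace_linear csM.
apply/seteqP; split=> x.
  move=> cx; split.
    apply: closed_nsq clM _ => e.
    by move/closure_nsqP: cx => /[apply] -[y /NM]; exists y.
  move=> y /hL[My hy]; apply/eqP; rewrite -sqrf_eq0 eq_le sqr_ge0 andbT.
  apply/ler_addgt0Pl => e e0; rewrite addr0.
  have k0 : 0 < nsq y + 1 by have := nsq_ge0 y; lra.
  move/closure_nsqP: cx => /(_ _ (divr_gt0 e0 k0))[z Nz].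
  rewrite ltr_pdivlMr//; have := cauchy_schwarz (x - z) y.
  rewrite rdotBl (rdotC z) hy// subr0.
  by have := nsq_ge0 (x - z); have := nsq_ge0 y; nra.
move=> [Mx hx]; set p := orth_proj (closure N) x.
have cp : closure N p by exact: orth_proj_in.
have Mp : M p.
  apply: closed_nsq clM _ => e.
  by move/closure_nsqP: cp => /[apply] -[y /NM]; exists y.
suff /nsq_eq0/eqP : nsq (x - p) = 0 by rewrite subr_eq0 => /eqP ->.
have [_ op] := orth_projP x csN.
rewrite {1}/nsq rdotBr (op p)// subr0 rdotC hx//.
apply/hL; split; first exact: subspaceB.
by move=> z Nz; rewrite op//; exact: subset_closure.
Qed.

Lemma image_linear_subspace M (F : H -> H) : linear_subspace M -> linear_on M F ->
  linear_subspace (F @` M).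
Proof.
move=> sM lF; have [M0 hM] := sM; split; first by exists 0; rewrite ?(linear_on0 sM).
move=> a _ _ [x Mx <-] [y My <-]; exists (a *: x + y); first exact: hM.
by rewrite lF.
Qed.

Lemma defect_spaceE M T : closed_subspace M -> contraction_op M T ->
  defect_space M T = ominus M (op_ker M (defect_op M T)).
Proof.
move=> csM cT; have [DM lD] := defect_op_linear csM cT.
have sM := closed_subspace_linear csM; have saD := defect_self_adjoint csM cT.
apply: closure_ominus => //; first exact: image_linear_subspace.
  by move=> _ [x Mx <-]; exact: DM.
move=> y; split=> [[My Dy]|[My h]].
  by split=> // _ [x Mx <-]; rewrite -saD// Dy rdot0l.
split=> //; apply: nsq_eq0; rewrite /nsq saD//; last exact: DM.
by apply: h; exists (defect_op M T y) => //; exact: DM.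
Qed.

(** The truncated spaces of an operator T in L(M), in all four cases of the
    definition at once. *)
Lemma trunc_spaceE M T n m : closed_subspace M -> contraction_op M T ->
  trunc_space M T n m = [set x | [/\ M x, nsq (iter n T x) = nsq x &
                                   nsq (iter m (adjoint M T) x) = nsq x]].
Proof.
move=> csM cT; have cTn := contraction_iter n cT.
have cTm := contraction_iter m (adjoint_contraction csM cT).
case: n m cTn cTm => [|n] [|m] cTn cTm.
- by apply/seteqP; split=> // x [].
- by rewrite /trunc_space ker_defectE//; apply/seteqP; split=> x []; split.
- by rewrite /trunc_space ker_defectE//; apply/seteqP; split=> x []; split.
- rewrite /trunc_space !ker_defectE//; apply/seteqP.
  by split=> x; [move=> [[? ?] []]|move=> []]; split.
Qed.

Lemma trunc_space_closed M T n m : closed_subspace M -> contraction_op M T ->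
  closed_subspace (trunc_space M T n m).
Proof.
move=> csM cT; have cTn := contraction_iter n cT.
have cTm := contraction_iter m (adjoint_contraction csM cT).
have [h1 h2] := (ker_defect_closed csM cTn, ker_defect_closed csM cTm).
by case: n m {cTn cTm} h1 h2 => [|n] [|m] // *; exact: closed_subspace_setI.
Qed.

End Defect.


(** * Unitary equivalence *)

Section UnitaryEquivalence.
Variables (R : realType) (H : hilbertType R).
Implicit Types (x y z : H) (M N L : set H) (S T U : H -> H).

Lemma unitarily_equivalent_refl M T : unitarily_equivalent M T M T.
Proof.
exists id; split=> //; split=> //; split=> //.
by move=> x Mx; exists x.
Qed.

Lemma unitarily_equivalent_sym M T N S : linear_subspace M -> set_fun M M T ->
  unitarily_equivalent M T N S -> unitarily_equivalent N S M T.
Proof.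
move=> [M0 hM] TM [U [[[UN Uinj Usurj] lU dU] UT]].
have /choice[V hV] : forall y, exists x, N y -> M x /\ U x = y.
  move=> y; have [/Usurj[x Mx <-]|nNy] := pselect (N y); first by exists x.
  by exists 0.
have VM y : N y -> M (V y) by move=> /hV[].
have UV y : N y -> U (V y) = y by move=> /hV[].
have VU x : M x -> V (U x) = x.
  move=> Mx; have [MV e] := hV _ (UN _ Mx).
  by apply: Uinj => //; exact/mem_set.
exists V; split; last first.
  move=> y Ny; rewrite -[in LHS](UV _ Ny) -UT ?VU//; [exact/TM/VM|exact: VM].
split=> [|a x y Nx Ny|x y Nx Ny].
- split=> [y Ny|x y /set_mem Nx /set_mem Ny e|x Mx]; first exact: VM.
    by rewrite -(UV _ Nx) e UV.
  by exists (U x); [exact: UN|rewrite VU].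
- rewrite -{1}(UV _ Nx) -{1}(UV _ Ny) -lU ?VU//; try exact: VM.
  by apply: hM; exact: VM.
- by rewrite -dU ?UV//; exact: VM.
Qed.

Lemma unitarily_equivalent_trans M T N S L B : set_fun M M T ->
  unitarily_equivalent M T N S -> unitarily_equivalent N S L B ->
  unitarily_equivalent M T L B.
Proof.
move=> TM [U [[bU lU dU] UT]] [V [[bV lV dV] VS]]; have [UN _ _] := bU.
exists (V \o U); split; last by move=> x Mx /=; rewrite UT// VS//; exact: UN.
split=> [|a x y Mx My|x y Mx My] /=; first exact: set_bij_comp bU bV.
  by rewrite lU// lV//; exact: UN.
by rewrite dV ?dU//; exact: UN.
Qed.

Lemma unitarily_equivalent_adjoint M T N S :
  closed_subspace M -> contraction_op M T ->
  closed_subspace N -> contraction_op N S ->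
  unitarily_equivalent M T N S ->
  unitarily_equivalent M (adjoint M T) N (adjoint N S).
Proof.
move=> csM cT csN cS [U [[[UN Uinj Usurj] lU dU] UT]]; exists U; split=> //.
have rU x y : M x -> M y -> rdot (U x) (U y) = rdot x y.
  by move=> Mx My; rewrite /rdot dU.
have [TM _ _] := cT.
move=> x Mx; apply/esym; apply: adjoint_unique => //.
  by apply: UN; exact: adjoint_in.
move=> _ /Usurj[v Mv <-]; have Ma := adjoint_in x csM cT.
by rewrite -UT// !rU// ?adjoint_rdot//; exact: TM.
Qed.

Lemma strongly_stable_transport M T N S : set_fun M M T ->
  unitarily_equivalent M T N S -> strongly_stable M T -> strongly_stable N S.
Proof.
move=> TM [U [[[UN _ Usurj] lU dU] UT]] st _ /Usurj[x Mx <-].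
have TMk k : M (iter k T x) by elim: k => //= k; exact: TM.
have e k : iter k S (U x) = U (iter k T x).
  by elim: k => //= k ->; rewrite UT.
apply: (@cvg0_nsq_le _ _ _ (fun k => iter k T x)); last exact: st.
by move=> k; rewrite e /nsq /rdot dU.
Qed.

End UnitaryEquivalence.

(** * The truncated spaces of a contraction *)

Section TruncatedSpaces.
Variables (R : realType) (H : hilbertType R) (A : H -> H).
Hypothesis cA : contraction_op setT A.
Implicit Types (x y z : H).

Local Notation As := (adjoint setT A).
Local Notation V := (trunc_space setT A).

Let csT : closed_subspace [set: H] := closed_subspace_setT H.

Lemma contraction_adjoint_setT : contraction_op setT As.
Proof. exact: adjoint_contraction csT cA. Qed.

Lemma adjointK_setT : adjoint setT As = A.
Proof. by apply/funext => x; rewrite adjointK. Qed.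

Lemma rdot_adjoint_setT x y : rdot x (As y) = rdot (A x) y.
Proof. by rewrite adjoint_rdot. Qed.

Lemma in_trunc n m x :
  V n m x <-> nsq (iter n A x) = nsq x /\ nsq (iter m As x) = nsq x.
Proof. by rewrite trunc_spaceE//; split=> [[]|[]]. Qed.

Lemma trunc_closed n m : closed_subspace (V n m).
Proof. exact: trunc_space_closed csT cA. Qed.

(** Exchanging A and its adjoint exchanges the two indices; by this symmetry,
    each fact below about A is also one about its adjoint. *)
Lemma trunc_space_dual n m : trunc_space setT As m n = V n m.
Proof.
have cAs := contraction_adjoint_setT.
rewrite !trunc_spaceE// adjointK_setT.
by apply/seteqP; split=> x [].
Qed.

Lemma trunc_AsA n m x : V n.+1 m x -> As (A x) = x.
Proof.
move=> /in_trunc[e _]; apply: adjoint_isomK => //.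
apply/eqP; rewrite eq_le (contraction_nsq cA)// -[leLHS]e iterSr.
exact: (contraction_nsq (contraction_iter n cA)).
Qed.

Lemma iter_isom_le T n k x : contraction_op setT T -> (k <= n)%N ->
  nsq (iter n T x) = nsq x -> nsq (iter k T x) = nsq x.
Proof.
move=> cT /subnK<- e; apply/eqP; rewrite eq_le.
rewrite (contraction_nsq (contraction_iter k cT))// -[leLHS]e iterD.
by rewrite (contraction_nsq (contraction_iter (n - k) cT)).
Qed.

Lemma trunc_subset n m n' m' : (n' <= n)%N -> (m' <= m)%N -> V n m `<=` V n' m'.
Proof.
move=> nn mm x /in_trunc[e1 e2]; apply/in_trunc; split.
  exact: iter_isom_le e1.
exact: iter_isom_le contraction_adjoint_setT mm e2.
Qed.

(** On V(n+1,m) the adjoint undoes A, so one step of A trades an isometric step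
    forwards for an isometric step backwards. *)
Lemma trunc_A n m x : V n.+1 m x -> V n m.+1 (A x).
Proof.
move=> Vx; have AsA := trunc_AsA Vx; move/in_trunc: Vx => [e1 e2].
have eA : nsq (A x) = nsq x by exact: (@iter_isom_le A n.+1 1).
by apply/in_trunc; rewrite -iterSr [iter m.+1 _ _]iterSr AsA e1 e2 eA.
Qed.

End TruncatedSpaces.

(** * Truncations of a contraction *)

(** What the two truncations of A to V(n,m) have in common, and all that the
    kernels, the defect spaces and complete non-unitarity depend on. *)
Definition truncation (R : realType) (H : hilbertType R) (A : H -> H) n m
    (B : H -> H) : Prop :=
  [/\ contraction_op (trunc_space setT A n m) B,
      forall x, trunc_space setT A n.+1 m x -> B x = A x &
      forall x, trunc_space setT A n m x -> nsq (B x) = nsq x ->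
        trunc_space setT A n.+1 m x].

Section Truncations.
Variables (R : realType) (H : hilbertType R) (A : H -> H).
Hypothesis cA : contraction_op setT A.
Implicit Types (x y z : H) (B : H -> H).

Local Notation As := (adjoint setT A).
Local Notation V := (trunc_space setT A).

Let cAs : contraction_op setT As := contraction_adjoint_setT cA.
Let csV n m : closed_subspace (V n m) := trunc_closed cA n m.
Let sV n m : linear_subspace (V n m) := closed_subspace_linear (csV n m).
Let sub := trunc_subset cA.

Lemma trunc_As n m x : V n m.+1 x -> V n.+1 m (As x).
Proof. by rewrite -!(trunc_space_dual cA); exact: trunc_A. Qed.

Lemma trunc_AAs n m x : V n m.+1 x -> A (As x) = x.
Proof.
rewrite -(trunc_space_dual cA) => /(trunc_AsA cAs).
by rewrite (adjointK_setT cA).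
Qed.

Lemma image_trunc n m : A @` V n.+1 m = V n m.+1.
Proof.
apply/seteqP; split=> [_ [x Vx <-]|x Vx]; first exact: trunc_A.
by exists (As x); [exact: trunc_As|exact: trunc_AAs Vx].
Qed.

Lemma image_trunc_adjoint n m : As @` V n m.+1 = V n.+1 m.
Proof.
apply/seteqP; split=> [_ [x Vx <-]|x Vx]; first exact: trunc_As.
by exists (A x); [exact: trunc_A|exact: trunc_AsA Vx].
Qed.

(** Since A maps V(n+1,m) onto V(n,m+1), with inverse its adjoint, it carries one
    projection to the other. *)
Lemma proj_intertwine n m x :
  orth_proj (V n m.+1) (A x) = A (orth_proj (V n.+1 m) x).
Proof.
apply: orth_proj_unique => //; first by apply: trunc_A => //; exact: orth_proj_in.
move=> z Vz; rewrite -!(rdot_adjoint_setT cA) orth_proj_rdot//.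
exact: trunc_As.
Qed.

Lemma isom_A n m x : V n.+1 m x -> nsq (A x) = nsq x.
Proof. by move=> /in_trunc; case=> // e _; exact: (@iter_isom_le _ _ A n.+1 1). Qed.

Lemma trunc_of_A n m x : V n m x -> nsq (A x) = nsq x -> V n m (A x) ->
  V n.+1 m x.
Proof.
move=> /in_trunc[//|e1 e2] e /in_trunc[//|e3 _].
by apply/in_trunc => //; rewrite iterSr e3 e.
Qed.

Lemma trunc_op_truncation n m : truncation A n m (trunc_op setT A n m).
Proof.
have [_ lA _] := cA; have lP := @orth_proj_linear _ _ _ setT (csV n m).
split.
- apply/contraction_opP; split=> [x _|a x y _ _|x _].
  + exact: orth_proj_in.
  + by rewrite /trunc_op lA// lP.
  + by apply: le_trans (orth_proj_le _ _) (contraction_nsq cA _).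
- move=> x Vx; apply: orth_proj_id => //.
  exact: sub (trunc_A cA Vx).
- move=> x Vx e.
  have eA : nsq (A x) = nsq x.
    apply/eqP; rewrite eq_le (contraction_nsq cA)// -[leLHS]e.
    exact: orth_proj_le.
  apply: trunc_of_A => //; rewrite -[A x](@orth_proj_isom _ _ (V n m))//.
    exact: orth_proj_in.
  by rewrite eA -e.
Qed.

Lemma cal_trunc_opE n m x :
  cal_trunc_op setT A n m x = A (orth_proj (V n.+1 m) x).
Proof.
rewrite /cal_trunc_op; have [_ -> //] := trunc_op_truncation n m.
exact: orth_proj_in.
Qed.

Lemma cal_trunc_op_truncation n m : truncation A n m (cal_trunc_op setT A n m).
Proof.
have [_ lA _] := cA; have lQ := @orth_proj_linear _ _ _ setT (csV n.+1 m).
split.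
- apply/contraction_opP; split=> [x _|a x y _ _|x _]; rewrite !cal_trunc_opE.
  + by apply: sub (trunc_A cA (orth_proj_in x _)).
  + by rewrite lQ// lA.
  + by apply: le_trans (contraction_nsq cA _) (orth_proj_le _ _).
- by move=> x Vx; rewrite cal_trunc_opE orth_proj_id.
- move=> x Vx; rewrite cal_trunc_opE => e.
  rewrite -[x](@orth_proj_isom _ _ (V n.+1 m))//; first exact: orth_proj_in.
  by rewrite -[leLHS]e (contraction_nsq cA).
Qed.

(** An orbit of B along which the norm is preserved is an orbit of A, since at
    each step B agrees with A.  Conversely, the first k points of the A-orbit of
    a vector of V(n+k,m) remain in V(n,m), because A lowers the first index and
    raises the second. *)
Lemma truncation_iter n m B k x : truncation A n m B -> V n m x ->
  nsq (iter k B x) = nsq x <-> V (n + k) m x.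
Proof.
move=> [cB BA hB]; elim: k x => [|k IH] x Vx; first by rewrite addn0.
rewrite iterSr addnS; split=> [e|Vk].
  have eB : nsq (B x) = nsq x.
    apply/eqP; rewrite eq_le (contraction_nsq cB)// -[leLHS]e.
    by apply: (contraction_nsq (contraction_iter k cB)); case: cB => + _ _; apply.
  have V1 := hB _ Vx eB; have VB : V n m (B x) by case: cB => + _ _; apply.
  move: e; rewrite -eB => /(IH _ VB); rewrite BA// => /in_trunc[//|e1 _].
  apply/in_trunc => //; rewrite iterSr e1 (isom_A V1)//.
  by case/in_trunc: Vx.
have V1 : V n.+1 m x by apply: sub Vk; rewrite ?ltnS ?leq_addr.
rewrite BA// -(isom_A V1); have VA := trunc_A cA Vk.
by apply/IH; apply: sub VA => //; rewrite leq_addr.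
Qed.

(** B maps V(n+1,m) isometrically onto V(n,m+1), as A does, and contracts strictly
    off V(n+1,m); so its adjoint inverts A on V(n,m+1), as the adjoint of A does,
    and contracts strictly off V(n,m+1). *)
Lemma truncation_adjoint n m B : truncation A n m B ->
  truncation As m n (adjoint (V n m) B).
Proof.
rewrite /truncation !(trunc_space_dual cA).
move=> [cB BA hB]; have cBs := adjoint_contraction (csV n m) cB; split=> //.
- move=> x Vx; have VAs := trunc_As Vx; have AAs := trunc_AAs Vx.
  have VAs0 : V n m (As x) by apply: sub VAs.
  have eB : B (As x) = x by rewrite BA.
  rewrite -{1}eB adjoint_isomK// eB.
  by rewrite -{1}AAs (isom_A VAs).
- move=> x Vx e; set y := adjoint (V n m) B x in e.
  have Vy : V n m y by exact: adjoint_in.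
  have By : B y = x by rewrite -(adjointK (csV n m) cB Vy) adjoint_isomK.
  have V1 : V n.+1 m y by apply: hB => //; rewrite By e.
  by rewrite -By BA//; exact: trunc_A.
Qed.

Lemma ker_defect_truncation n m k B : truncation A n m B ->
  op_ker (V n m) (defect_op (V n m) (iter k B)) = V (n + k) m.
Proof.
move=> tB; have [cB _ _] := tB; rewrite ker_defectE//; last exact: contraction_iter.
apply/seteqP; split=> x; first by case=> Vx /(truncation_iter _ tB Vx).
move=> Vk; have Vx : V n m x by apply: sub Vk => //; exact: leq_addr.
by split=> //; exact/(truncation_iter _ tB Vx).
Qed.

Lemma defect_space_truncation n m B : truncation A n m B ->
  defect_space (V n m) B = ominus (V n m) (V n.+1 m).
Proof.
move=> tB; have [cB _ _] := tB; rewrite defect_spaceE//; congr ominus.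
by have := ker_defect_truncation 1 tB; rewrite addn1.
Qed.

(** A subspace on which a truncation is unitary lies in V(n+1,m), where the
    truncation agrees with A; so it reduces A to a unitary operator. *)
Lemma truncation_cnu n m B : completely_nonunitary setT A ->
  truncation A n m B -> completely_nonunitary (V n m) B.
Proof.
move=> cnuA [cB BA hB] N [csN NV _ _] [[BN Binj Bsurj] lB dB].
have N1 x : N x -> V n.+1 m x.
  by move=> Nx; apply: hB; [exact: NV|rewrite /nsq /rdot dB].
have BAN x : N x -> B x = A x by move=> /N1/BA.
apply: cnuA.
- split=> //.
    by move=> _ [x Nx <-]; rewrite -BAN//; exact: BN.
  move=> _ [x /Bsurj[y Ny <-] <-]; rewrite BAN//.
  by rewrite (trunc_AsA cA (N1 _ Ny)).
- split; first split.
  + by move=> x Nx; rewrite -BAN//; exact: BN.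
  + move=> x y Nx Ny; rewrite -!BAN; [exact: Binj|exact/set_mem|exact/set_mem].
  + by move=> x /Bsurj[y Ny <-]; exists y; rewrite ?BAN.
  + by case: cA => _ lA _ a x y _ _; apply: lA.
  + by move=> x y Nx Ny; rewrite -!BAN// dB.
Qed.

(** Within V(n,m), being orthogonal to the range of P_(n,m) D is lying in the kernel
    of D, where D is the defect operator of A^(n+1). *)
Lemma closure_proj_defect n m :
  closure ((fun x => orth_proj (V n m) (defect_op setT (iter n.+1 A) x)) @` setT)
  = ominus (V n m) (V n.+1 m).
Proof.
have csT := closed_subspace_setT H; have cAn := contraction_iter n.+1 cA.
have [_ lD] := defect_op_linear csT cAn.
apply: closure_ominus => //.
- apply: image_linear_subspace; first exact: closed_subspace_linear.
  by move=> a x y _ _; rewrite lD// (@orth_proj_linear _ _ _ setT).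
- by move=> _ [x _ <-]; exact: orth_proj_in.
move=> y; have nD := nsq_defect csT cAn (I : setT y).
split=> [Vy|[Vy h]].
  split=> [|_ [x _ <-]]; first exact: sub Vy.
  have Dy : defect_op setT (iter n.+1 A) y = 0.
    by apply: nsq_eq0; rewrite nD; case/in_trunc: Vy => // -> _; rewrite subrr.
  rewrite rdotC orth_proj_rdot//; last exact: sub Vy.
  by rewrite (defect_self_adjoint csT cAn)// Dy rdot0r.
apply/in_trunc => //; split; last by case/in_trunc: Vy.
apply/esym/eqP; rewrite -subr_eq0 -nD; apply/eqP.
rewrite /nsq (defect_self_adjoint csT cAn)//.
rewrite rdotC -(orth_proj_rdot _ (csV n m) Vy) rdotC; apply: h.
by exists (defect_op setT (iter n.+1 A) y).
Qed.

Lemma adjoint_trunc_op n m x : V n m x ->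
  adjoint (V n m) (trunc_op setT A n m) x = orth_proj (V n m) (As x).
Proof.
move=> Vx; have [cB _ _] := trunc_op_truncation n m.
apply: adjoint_unique => //; first exact: orth_proj_in.
move=> y Vy; rewrite orth_proj_rdot// rdotC [RHS]rdotC orth_proj_rdot//.
by rewrite rdotC [RHS]rdotC rdot_adjoint_setT.
Qed.

Lemma adjoint_cal_trunc_op n m x : V n m x ->
  adjoint (V n m) (cal_trunc_op setT A n m) x = orth_proj (V n.+1 m) (As x).
Proof.
move=> Vx; have [cB _ _] := cal_trunc_op_truncation n m.
apply: adjoint_unique => //; first by apply: sub (orth_proj_in _ _).
move=> y Vy; have Qy := orth_proj_in y (csV n.+1 m).
have Qx := orth_proj_in (As x) (csV n.+1 m).
rewrite cal_trunc_opE -(rdot_adjoint_setT cA) rdotC.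
by rewrite -(orth_proj_rdot _ (csV n.+1 m) Qy) rdotC orth_proj_rdot.
Qed.

Lemma trunc_op_intertwine n m x :
  trunc_op setT A n m.+1 (A x) = A (trunc_op setT A n.+1 m x).
Proof. exact: proj_intertwine. Qed.

Lemma cal_trunc_op_intertwine n m x :
  cal_trunc_op setT A n m.+1 (A x) = A (cal_trunc_op setT A n.+1 m x).
Proof. by rewrite !cal_trunc_opE !proj_intertwine. Qed.

Lemma A_unitary n m : unitary_op (V n.+1 m) (V n m.+1) A.
Proof.
split; first split.
- by move=> x; exact: trunc_A.
- move=> x y /set_mem Vx /set_mem Vy e.
  by rewrite -(trunc_AsA cA Vx) e (trunc_AsA cA Vy).
- by move=> y; rewrite -image_trunc.
- by case: cA => _ lA _ a x y _ _; apply: lA.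
- move=> x y _ Vy; rewrite (@adjoint_hdot _ _ setT)//.
  by rewrite (trunc_AsA cA Vy).
Qed.

(** A family of operators on the V(n,m) that A intertwines along an antidiagonal
    n + m = const consists of unitarily equivalent operators. *)
Lemma antidiagonal_equivalent (B : nat -> nat -> H -> H) :
  (forall n m, set_fun (V n m) (V n m) (B n m)) ->
  (forall n m x, B n m.+1 (A x) = A (B n.+1 m x)) ->
  forall n i j, (i <= n)%N -> (j <= n)%N ->
    unitarily_equivalent (V (n - i) i) (B (n - i)%N i)
                         (V (n - j) j) (B (n - j)%N j).
Proof.
move=> BV BA n.
have from0 i : (i <= n)%N ->
    unitarily_equivalent (V n 0) (B n 0%N) (V (n - i) i) (B (n - i)%N i).
  elim: i => [_|i IH lt_in]; first by rewrite subn0; exact: unitarily_equivalent_refl.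
  apply: unitarily_equivalent_trans (IH (ltnW lt_in)) _ => //.
  rewrite -(subnSK lt_in); exists A; split; first exact: A_unitary.
  by move=> x _; rewrite BA.
move=> i j le_in le_jn.
apply: unitarily_equivalent_trans (from0 j le_jn) => //.
exact: unitarily_equivalent_sym (from0 i le_in).
Qed.

(** With Q the projection on V(n+1,0), the calligraphic truncation is A Q and the
    truncation to V(n+1,0) is Q A; their powers are linked by
    (A Q)^(k+1) = A (Q A)^k Q and, on V(n+1,0), by (Q A)^k = Q (A Q)^k. *)
Lemma strongly_stable_cal_trunc n :
  strongly_stable (V n 0) (cal_trunc_op setT A n 0) <->
  strongly_stable (V n.+1 0) (trunc_op setT A n.+1 0).
Proof.
set B := cal_trunc_op _ _ _ _; set T := trunc_op _ _ _ _.
pose Q := orth_proj (V n.+1 0).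
have Qle x : nsq (Q x) <= nsq x by exact: orth_proj_le.
have QB k x : Q (iter k B x) = iter k T (Q x).
  by elim: k => //= k <-; rewrite /B cal_trunc_opE.
split=> st x Vx.
  apply: (@cvg0_nsq_le _ _ _ (fun k => iter k B x)).
    by move=> k; rewrite -[in leLHS](orth_proj_id (csV n.+1 0) Vx) -QB.
  by apply: st; exact: sub Vx.
rewrite -cvg_shiftS.
apply: (@cvg0_nsq_le _ _ _ (fun k => iter k T (Q x))).
  move=> k; rewrite -QB /= {1}/B cal_trunc_opE.
  exact: (contraction_nsq cA).
by apply: st; exact: orth_proj_in.
Qed.

(** Both adjoints act as x |-> Q A^* x, one on V(n,0) and the other on V(n+1,0),
    and Q A^* maps the first space into the second. *)
Lemma strongly_stable_adjoint_cal_trunc n :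
  strongly_stable (V n 0) (adjoint (V n 0) (cal_trunc_op setT A n 0)) <->
  strongly_stable (V n.+1 0) (adjoint (V n.+1 0) (trunc_op setT A n.+1 0)).
Proof.
set B := adjoint _ _; set T := adjoint _ _.
pose S x := orth_proj (V n.+1 0) (As x).
have S1 x : V n.+1 0 (S x) by exact: orth_proj_in.
have S0 x : V n 0 (S x) by exact: sub (S1 x).
have BS k x : V n 0 x -> iter k B x = iter k S x.
  by apply: iter_ext => [y _|y]; [exact: S0|exact: adjoint_cal_trunc_op].
have TS k x : V n.+1 0 x -> iter k T x = iter k S x.
  by apply: iter_ext => [y _|y]; [exact: S1|exact: adjoint_trunc_op].
split=> st x Vx.
  have V0 : V n 0 x by exact: sub Vx.
  under eq_fun do rewrite TS// -BS//.
  exact: st.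
rewrite -cvg_shiftS; under eq_fun do rewrite BS// iterSr -TS//.
exact/st/S1.
Qed.

End Truncations.

(** Passing to adjoints by [truncation_adjoint] gives the statements about the
    second index. *)
Section DualTruncations.
Variables (R : realType) (H : hilbertType R) (A : H -> H).
Hypothesis cA : contraction_op setT A.
Variables (n m : nat) (B : H -> H).
Hypothesis tB : truncation A n m B.

Local Notation As := (adjoint setT A).
Local Notation V := (trunc_space setT A).
Local Notation Bs := (adjoint (V n m) B).

Let cAs : contraction_op setT As := contraction_adjoint_setT cA.
Let tBs : truncation As m n Bs := truncation_adjoint cA tB.

Lemma ker_defect_truncation_adjoint k :
  op_ker (V n m) (defect_op (V n m) (iter k Bs)) = V n (m + k).
Proof.
by have := ker_defect_truncation cAs k tBs; rewrite !(trunc_space_dual cA).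
Qed.

Lemma defect_space_truncation_adjoint :
  defect_space (V n m) Bs = ominus (V n m) (V n m.+1).
Proof.
by have := defect_space_truncation cAs tBs; rewrite !(trunc_space_dual cA).
Qed.

Lemma trunc_space_truncation k l : trunc_space (V n m) B k l = V (n + k) (m + l).
Proof.
have [cB _ _] := tB; rewrite trunc_spaceE//; last exact: trunc_closed.
have itB x : V n m x -> nsq (iter k B x) = nsq x <-> V (n + k) m x.
  exact: truncation_iter.
have itBs x : V n m x -> nsq (iter l Bs x) = nsq x <-> V n (m + l) x.
  have := truncation_iter cAs l tBs (x := x).
  by rewrite !(trunc_space_dual cA).
apply/seteqP; split=> x.
  move=> [Vx /(itB _ Vx) Vk /(itBs _ Vx) Vl].
  by apply/in_trunc => //; case/in_trunc: Vk => //; case/in_trunc: Vl.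
move=> Vkl; have Vx : V n m x by apply: trunc_subset Vkl; rewrite ?leq_addr.
by split=> //; [apply/itB|apply/itBs] => //; apply: trunc_subset Vkl;
  rewrite ?leq_addr.
Qed.

End DualTruncations.


Unset Implicit Arguments.

Theorem theorem3p1 (R : realType) (H : hilbertType R) (A : H -> H)
    (sepH : separable_space H)
    (contrA : contraction_op setT A)
    (cnuA : completely_nonunitary setT A)
    (kerDA : op_ker setT (defect_op setT A) <> [set 0]) :
  let As : H -> H := adjoint setT A in
  let H_ (n m : nat) : set H := trunc_space setT A n m in
  let P_ (n m : nat) : H -> H := orth_proj (H_ n m) in
  let A_ (n m : nat) : H -> H := trunc_op setT A n m in
  let A_s (n m : nat) : H -> H := adjoint (H_ n m) (A_ n m) in
  let cA_ (n m : nat) : H -> H := cal_trunc_op setT A n m in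
  let cA_s (n m : nat) : H -> H := adjoint (H_ n m) (cA_ n m) in
  let kerD (n m : nat) (T : H -> H) : set H :=
    op_ker (H_ n m) (defect_op (H_ n m) T) in
  (* (1) *)
  ((forall n m k : nat, (0 < k)%N ->
       kerD n m (iter k (A_ n m)) = H_ (n + k)%N m /\
       kerD n m (iter k (A_s n m)) = H_ n (m + k)%N) /\
   (forall n m : nat,
       defect_space (H_ n m) (A_ n m) =
         closure ((fun x => P_ n m (defect_op setT (iter n.+1 A) x)) @` setT) /\
       defect_space (H_ n m) (A_s n m) =
         closure ((fun x => P_ n m (defect_op setT (iter m.+1 As) x)) @` setT)) /\
   (forall n m : nat, (1 <= n)%N -> A @` H_ n m = H_ n.-1 m.+1) /\
   (forall n m : nat, (1 <= m)%N -> As @` H_ n m = H_ n.+1 m.-1) /\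
   (forall n m k : nat, (0 < k)%N ->
       kerD n m (iter k (cA_ n m)) = H_ (n + k)%N m /\
       kerD n m (iter k (cA_s n m)) = H_ n (m + k)%N) /\
   (forall n m : nat,
       defect_space (H_ n m) (cA_ n m) = defect_space (H_ n m) (A_ n m) /\
       defect_space (H_ n m) (cA_s n m) = defect_space (H_ n m) (A_s n m)) /\
   (forall n m k l : nat,
       trunc_space (H_ n m) (A_ n m) k l = H_ (n + k)%N (m + l)%N /\
       (forall f : H, H_ (n + k)%N (m + l)%N f ->
          trunc_op (H_ n m) (A_ n m) k l f = A_ (n + k)%N (m + l)%N f))) /\
  (* (2) *)
  (forall n m : nat,
     (contraction_op (H_ n m) (A_ n m) /\
      completely_nonunitary (H_ n m) (A_ n m)) /\
     (contraction_op (H_ n m) (cA_ n m) /\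
      completely_nonunitary (H_ n m) (cA_ n m))) /\
  (* (3) *)
  ((forall n : nat, (1 <= n)%N ->
      forall i j : nat, (i <= n)%N -> (j <= n)%N ->
        unitarily_equivalent (H_ (n - i)%N i) (A_ (n - i)%N i)
                             (H_ (n - j)%N j) (A_ (n - j)%N j)) /\
   (forall (n m : nat) (f : H), (1 <= n)%N -> H_ n m f ->
        A_ n.-1 m.+1 (A f) = A (A_ n m f))) /\
  (* (4) *)
  ((forall n : nat, (1 <= n)%N ->
      forall i j : nat, (i <= n)%N -> (j <= n)%N ->
        unitarily_equivalent (H_ (n - i)%N i) (cA_ (n - i)%N i)
                             (H_ (n - j)%N j) (cA_ (n - j)%N j)) /\
   (forall (n m : nat) (f : H), (1 <= n)%N -> H_ n m f ->
        cA_ n.-1 m.+1 (A f) = A (cA_ n m f))) /\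
  (* (5) *)
  (forall n : nat,
     (class_C_0 (H_ n 0%N) (cA_ n 0%N) <->
      forall k : nat, (k <= n.+1)%N ->
        class_C_0 (H_ (n.+1 - k)%N k) (A_ (n.+1 - k)%N k)) /\
     (class_C0_ (H_ n 0%N) (cA_ n 0%N) <->
      forall k : nat, (k <= n.+1)%N ->
        class_C0_ (H_ (n.+1 - k)%N k) (A_ (n.+1 - k)%N k))).
Proof.
have cAs := contraction_adjoint_setT contrA.
have csV := trunc_closed contrA; have sub := trunc_subset contrA.
have dual n m : trunc_space setT (adjoint setT A) m n = trunc_space setT A n m.
  exact: trunc_space_dual.
have tA n m : truncation A n m (trunc_op setT A n m).
  exact: trunc_op_truncation.
have tcA n m : truncation A n m (cal_trunc_op setT A n m).
  exact: cal_trunc_op_truncation.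
have ctA n m := let: And3 c _ _ := tA n m in c.
have ctcA n m := let: And3 c _ _ := tcA n m in c.
move=> As H_ P_ A_ A_s cA_ cA_s kerD.
have kerB n m B k : truncation A n m B ->
    kerD n m (iter k B) = H_ (n + k)%N m /\
    kerD n m (iter k (adjoint (H_ n m) B)) = H_ n (m + k)%N.
  by split; [exact: ker_defect_truncation|exact: ker_defect_truncation_adjoint].
have defB n m B : truncation A n m B ->
    defect_space (H_ n m) B = ominus (H_ n m) (H_ n.+1 m) /\
    defect_space (H_ n m) (adjoint (H_ n m) B) = ominus (H_ n m) (H_ n m.+1).
  by split; [exact: defect_space_truncation|exact: defect_space_truncation_adjoint].
have equiv_A n i j : (i <= n)%N -> (j <= n)%N ->
    unitarily_equivalent (H_ (n - i)%N i) (A_ (n - i)%N i)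
                         (H_ (n - j)%N j) (A_ (n - j)%N j).
  apply: (antidiagonal_equivalent contrA (B := A_)) => [a b|a b x].
    by case: (ctA a b).
  exact: trunc_op_intertwine.
split; [|split; [|split; [|split]]].
- split; [|split; [|split; [|split; [|split; [|split]]]]].
  + by move=> n m k _; exact: kerB.
  + move=> n m; have [-> ->] := defB n m _ (tA n m); split.
      by rewrite closure_proj_defect.
    by have := closure_proj_defect cAs m n; rewrite !dual => <-.
  + by move=> [//|n] m _; exact: image_trunc.
  + by move=> n [//|m] _; exact: image_trunc_adjoint.
  + by move=> n m k _; exact: kerB.
  + move=> n m; have [-> ->] := defB n m _ (tA n m).
    exact: defB (tcA n m).
  + move=> n m k l.
    have e := trunc_space_truncation contrA (tA n m) k l.
    split=> // f _; rewrite /trunc_op e; apply: orth_proj_sub => //.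
    by apply: sub; exact: leq_addr.
- move=> n m; split; split.
  + exact: ctA.
  + by move=> N; exact: truncation_cnu (tA n m) _.
  + exact: ctcA.
  + by move=> N; exact: truncation_cnu (tcA n m) _.
- split=> [n _ i j|[//|n] m f _ _]; first exact: equiv_A.
  exact: trunc_op_intertwine.
- split=> [n _ i j|[//|n] m f _ _]; last exact: cal_trunc_op_intertwine.
  apply: (antidiagonal_equivalent contrA (B := cA_)) => [a b|a b x].
    by case: (ctcA a b).
  exact: cal_trunc_op_intertwine.
- move=> n; split.
    rewrite /class_C_0 strongly_stable_adjoint_cal_trunc//.
    split=> [st k kn|/(_ 0%N isT)]; last by rewrite subn0.
    have eq0k := equiv_A n.+1 0%N k isT kn; rewrite subn0 in eq0k.
    apply: strongly_stable_transport st; last first.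
      exact: unitarily_equivalent_adjoint eq0k.
    by case: (adjoint_contraction (csV _ _) (ctA n.+1 0%N)).
  rewrite /class_C0_ strongly_stable_cal_trunc//.
  split=> [st k kn|/(_ 0%N isT)]; last by rewrite subn0.
  have eq0k := equiv_A n.+1 0%N k isT kn; rewrite subn0 in eq0k.
  by apply: strongly_stable_transport eq0k st; case: (ctA n.+1 0%N).
Qed.
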